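(* Let $f,g,h,\gamma$ and $\mathcal{X}=\operatorname{dom}(g)\subseteq\mathbb{R}^n$ satisfy the standing assumptions (A1)-(A4) and (G1)-(G4) of the context, with constant $\overline t>0$ from (G3), and fix a step size $t\in(0,\overline t)$. Suppose that there exists a spurious stationary point $\tilde{\boldsymbol x}^\star\in\mathcal{X}$ of the problem $\min_{\boldsymbol x\in\mathbb{R}^n}F(\boldsymbol x)=f(\boldsymbol x)+g(\boldsymbol x)$. Then for every $K\in\mathbb{N}$ and every $\epsilon>0$ there exists an initial point $\boldsymbol x^0\in\mathbb{B}_\epsilon(\tilde{\boldsymbol x}^\star)\cap\mathcal{X}\cap\operatorname{int}(\operatorname{dom} h)$ such that the sequence generated by $$\boldsymbol x^{k+1}=\operatorname*{argmin}_{\boldsymbol y\in\mathbb{R}^n}\Big\{\gamma(\boldsymbol y;\boldsymbol x^k)+g(\boldsymbol y)+\frac1tD_h(\boldsymbol y,\boldsymbol x^k)\Big\}$$ satisfies $\boldsymbol x^k\in\mathbb{B}_\epsilon(\tilde{\boldsymbol x}^\star)$ for all $k\in[K]$.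
   Context: Notation: $[K]=\{1,\dots,K\}$; $\mathbb{B}_\epsilon(\boldsymbol x)=\{\boldsymbol y\in\mathbb{R}^n:\|\boldsymbol x-\boldsymbol y\|\le\epsilon\}$. Here $f:\mathbb{R}^n\to\mathbb{R}$ and $g:\mathbb{R}^n\to\overline{\mathbb{R}}$ (extended-real-valued). Separable kernel function: $h:\mathbb{R}^n\to\overline{\mathbb{R}}$ is a separable kernel function if (1) $h(\boldsymbol x)=\sum_{i=1}^n\varphi(x_i)$ for some $\varphi:\mathbb{R}\to\overline{\mathbb{R}}$ that is continuously differentiable on $\operatorname{int}(\operatorname{dom}\varphi)$; (2) for every sequence $\{x^k\}\subset\operatorname{int}(\operatorname{dom}\varphi)$ converging to a point of $\operatorname{bd}(\operatorname{dom}\varphi)$, $|\varphi'(x^k)|\to+\infty$; (3) $\varphi$ is strictly convex. Bregman divergence: $D_h(\boldsymbol y,\boldsymbol x)=h(\boldsymbol y)-h(\boldsymbol x)-\nabla h(\boldsymbol x)^\top(\boldsymbol y-\boldsymbol x)$ for $\boldsymbol x\in\operatorname{int}(\operatorname{dom} h)$ (equal to $+\infty$ if $\boldsymbol y\notin\operatorname{dom} h$). Standing assumptions on the problem: $\operatorname{dom}(g)=\mathcal{X}$ is a nonempty closed convex set and (A1) $f$ is continuously differentiable on $\mathcal{X}$; (A2) $g$ is convex and locally Lipschitz continuous on $\mathcal{X}$; (A3) $\operatorname{int}(\operatorname{dom} h)\cap\mathcal{X}\neq\emptyset$ and $\mathcal{X}\subseteq\operatorname{cl}(\operatorname{dom}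 h)$; (A4) $h$ is a separable kernel function. Standing assumptions on the surrogate model $\gamma(\cdot;\cdot)$ ($\nabla\gamma(\boldsymbol y;\boldsymbol x)$ denotes the gradient in $\boldsymbol y$): (G1) $(\boldsymbol x,\boldsymbol y)\mapsto\gamma(\boldsymbol y;\boldsymbol x)$ and $(\boldsymbol x,\boldsymbol y)\mapsto\nabla\gamma(\boldsymbol y;\boldsymbol x)$ are jointly continuous for $\boldsymbol y\in\mathcal{X}$, $\boldsymbol x\in\mathcal{X}$; (G2) for all $\boldsymbol x\in\mathcal{X}$, $\nabla\gamma(\boldsymbol y;\boldsymbol x)|_{\boldsymbol y=\boldsymbol x}=\nabla f(\boldsymbol x)$ and $\gamma(\boldsymbol x;\boldsymbol x)=f(\boldsymbol x)$; (G3) there is a constant $\overline t>0$ such that for all $\boldsymbol x\in\mathcal{X}$ the function $\overline t(\gamma(\cdot;\boldsymbol x)+g(\cdot))+h(\cdot)$ is strictly convex; (G4) either $\mathcal{X}$ is compact, or for all $t\in(0,\overline t]$ and all sequences $\{\boldsymbol z^k\},\{\boldsymbol y^k\}\subseteq\operatorname{int}(\operatorname{dom} h)\cap\mathcal{X}$ with $\|\boldsymbol y^k\|\to+\infty$ and $\boldsymbol z^k\to\overline{\boldsymbol z}\in\mathcal{X}$, $\lim_{k\to\infty}\gamma(\boldsymbol y^k;\boldsymbol z^k)+g(\boldsymbol y^k)+\frac1tD_h(\boldsymbol y^k,\boldsymbol z^k)=+\infty$. (Under these assumptions, for $\boldsymbol x^k\in\operatorname{int}(\operatorname{dom} h)\cap\mathcal{X}$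 the update $\boldsymbol x^{k+1}$ is a uniquely determined point of $\operatorname{int}(\operatorname{dom} h)\cap\mathcal{X}$.) Affine manifold: $\mathcal{B}(\boldsymbol x)=\{b\in[n]:x_b\in\operatorname{bd}(\operatorname{dom}\varphi)\}$, $\mathcal{M}(\boldsymbol x)=\{\boldsymbol y\in\mathbb{R}^n:\boldsymbol y_{\mathcal{B}(\boldsymbol x)}=\boldsymbol x_{\mathcal{B}(\boldsymbol x)}\}$, with tangent space $T_{\mathcal{M}(\boldsymbol x)}=\{\boldsymbol v\in\mathbb{R}^n:\boldsymbol v_{\mathcal{B}(\boldsymbol x)}=\boldsymbol 0\}$. For $\boldsymbol u\in\mathcal{M}(\boldsymbol x)$: $\nabla_{\mathcal{M}(\boldsymbol x)}f(\boldsymbol u):=\operatorname{proj}_{T_{\mathcal{M}(\boldsymbol x)}}(\nabla f(\boldsymbol u))$ and $\partial_{\mathcal{M}(\boldsymbol x)}g(\boldsymbol u):=\{\boldsymbol v\in T_{\mathcal{M}(\boldsymbol x)}:g(\boldsymbol y)-g(\boldsymbol u)\ge\boldsymbol v^\top(\boldsymbol y-\boldsymbol u)\ \forall\boldsymbol y\in\mathcal{M}(\boldsymbol x)\}$. Spurious stationary point: a point $\boldsymbol x\in\mathcal{X}$ with $\boldsymbol 0\in\nabla_{\mathcal{M}(\boldsymbol x)}f(\boldsymbol x)+\partial_{\mathcal{M}(\boldsymbol x)}g(\boldsymbol x)$ but $\boldsymbol 0\notin\partial F(\boldsymbol x)$, where $\partial F(\boldsymbol x)=\nabla f(\boldsymbol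 x)+\partial g(\boldsymbol x)$ and $\partial g$ is the convex subdifferential. *)

(* Defs.v *)
From mathcomp Require Import all_boot all_order all_algebra.
From mathcomp Require Import all_classical all_reals all_analysis.

Set Implicit Arguments.
Unset Strict Implicit.
Unset Printing Implicit Defensive.
Import Order.TTheory GRing.Theory Num.Theory.
Import numFieldNormedType.Exports.
Local Open Scope classical_set_scope.
Local Open Scope ring_scope.

Section ExtendedRealFunctions.
Context {R : realType}.

Definition dom {T : Type} (F : T -> \bar R) : set T := [set x | (F x < +oo)%E].

Definition bd {T : topologicalType} (A : set T) : set T := closure A `\` A°.

(* The inequalities are only required between points of [dom F], where
   [F < +oo]; the right-hand sides therefore never involve [+oo - oo], and
   convexity of [dom F] is a consequence. *)
Definition econvex {V : lmodType R} (F : V -> \bar R) : Prop :=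
  forall (x y : V) (l : R), dom F x -> dom F y -> 0 < l < 1 ->
    (F (l *: x + (1 - l) *: y)%R <= l%:E * F x + (1 - l)%R%:E * F y)%E.

Definition estrictly_convex {V : lmodType R} (F : V -> \bar R) : Prop :=
  forall (x y : V) (l : R), dom F x -> dom F y -> x != y -> 0 < l < 1 ->
    (F (l *: x + (1 - l) *: y)%R < l%:E * F x + (1 - l)%R%:E * F y)%E.

Definition argmin {T : Type} (F : T -> \bar R) : set T :=
  [set y | forall z, (F y <= F z)%E].

End ExtendedRealFunctions.

Section EuclideanSpace.
Context {R : realType} {n : nat}.
Implicit Types (u v x y : 'rV[R]_n) (A : set 'rV[R]_n).

Definition dotp u v : R := \sum_(i < n) u 0 i * v 0 i.

(* The library norm on ['rV[R]_n] is the sup norm, which induces the same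
   topology. *)
Definition norm2 u : R := Num.sqrt (dotp u u).

Definition eball x (e : R) : set 'rV[R]_n := [set y | norm2 (x - y) <= e].

Definition gradient (f : 'rV[R]_n -> R) x : 'rV[R]_n :=
  \row_(i < n) 'D_(delta_mx 0 i) f x.

Definition proj A v : 'rV[R]_n :=
  xget 0 [set w | A w /\ forall u, A u -> norm2 (v - w) <= norm2 (v - u)].

Definition subdiff (g : 'rV[R]_n -> \bar R) u : set 'rV[R]_n :=
  [set v | forall y, ((dotp v (y - u)%R)%:E <= g y - g u)%E].

End EuclideanSpace.

Section Kernel.
Context {R : realType} {n : nat}.

Record separable_kernel (phi : R -> \bar R) (h : 'rV[R]_n -> \bar R) : Prop := {
  kernel_sum : forall x, h x = (\sum_(i < n) phi (x 0%R i))%E ;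
  kernel_C1 : forall s, (dom phi)° s ->
    [/\ phi s \is a fin_num, derivable (fine \o phi) s 1
      & {for s, continuous (derive1 (fine \o phi))}] ;
  kernel_steep : forall (u : nat -> R) (s : R),
    (forall k, (dom phi)° (u k)) -> bd (dom phi) s -> u @ \oo --> s ->
    `|derive1 (fine \o phi) (u k)| @[k --> \oo] --> +oo ;
  kernel_strictly_convex : estrictly_convex (phi : R^o -> \bar R) }.

(* Meaningful for [x] in the interior of [dom h]; there [h x] is finite, so
   the value is [+oo] as soon as [y] is not in [dom h]. *)
Definition bregman (h : 'rV[R]_n -> \bar R) (y x : 'rV[R]_n) : \bar R :=
  (h y - h x - (dotp (gradient (fine \o h) x) (y - x)%R)%:E)%E.

End Kernel.

Section Assumptions.
Context {R : realType} {n : nat}.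
Implicit Types (f : 'rV[R]_n -> R) (g h : 'rV[R]_n -> \bar R).
Implicit Types (phi : R -> \bar R) (X : set 'rV[R]_n).
Implicit Types (gamma : 'rV[R]_n -> 'rV[R]_n -> R).

(* The real-valued function [fine \o g] agrees with [g] on [X] because [g] is
   required to be finite there. *)
Record problem_assumptions f g phi h X : Prop := {
  X_dom : dom g = X ;
  X_nonempty : X !=set0 ;
  X_closed : closed X ;
  X_convex : convex_set X ;
  f_C1 : (forall x, X x -> differentiable f x) /\
       {within X, continuous (gradient f)} ;
  g_convex_lip : [/\ econvex g, forall x, X x -> g x \is a fin_num
         & [locally [lipschitz fine (g x) | x in X]]] ;
  X_domh : (dom h)° `&` X !=set0 /\ X `<=` closure (dom h) ;
  h_kernel : separable_kernel phi h }.

(* The objective minimised in [y] at each step; [gamma y x] stands for the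
   model value at [y] built at the base point [x]. *)
Definition subproblem gamma g h (t : R) (y x : 'rV[R]_n) : \bar R :=
  ((gamma y x)%:E + g y + (t^-1)%R%:E * bregman h y x)%E.

Record surrogate_assumptions f g h X gamma (tbar : R) : Prop := {
  gamma_C1 : [/\ {within X `*` X, continuous (fun p => gamma p.1 p.2)},
           forall y x, X y -> X x -> differentiable (gamma ^~ x) y
         & {within X `*` X,
              continuous (fun p => gradient (gamma ^~ p.2) p.1)}] ;
  gamma_first_order : forall x, X x ->
    gradient (gamma ^~ x) x = gradient f x /\ gamma x x = f x ;
  gamma_strictly_convex : 0 < tbar /\ forall x, X x ->
    estrictly_convex
      (fun y => (tbar%:E * ((gamma y x)%:E + g y) + h y)%E) ;
  gamma_coercive : compact X \/
    forall (t : R) (z y : nat -> 'rV[R]_n) (zbar : 'rV[R]_n),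
      0 < t <= tbar ->
      (forall k, ((dom h)° `&` X) (z k)) ->
      (forall k, ((dom h)° `&` X) (y k)) ->
      norm2 (y k) @[k --> \oo] --> +oo ->
      z @ \oo --> zbar -> X zbar ->
      subproblem gamma g h t (y k) (z k) @[k --> \oo] --> +oo%E }.

(* Membership in [(dom h)° `&` X] keeps the Bregman term meaningful along the
   sequence; the second component says that each iterate is the unique
   minimiser. *)
Definition generated gamma g h X (t : R) (x : nat -> 'rV[R]_n) : Prop :=
  forall k, ((dom h)° `&` X) (x k) /\
    argmin (fun y => subproblem gamma g h t y (x k)) = [set x k.+1].

End Assumptions.

Section SpuriousStationarity.
Context {R : realType} {n : nat}.
Implicit Types (phi : R -> \bar R) (x u : 'rV[R]_n).
Implicit Types (f : 'rV[R]_n -> R) (g : 'rV[R]_n -> \bar R).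

Definition Bset phi x : set 'I_n := [set b | bd (dom phi) (x 0 b)].

Definition manifold phi x : set 'rV[R]_n :=
  [set y | forall b, Bset phi x b -> y 0 b = x 0 b].

Definition tangent phi x : set 'rV[R]_n :=
  [set v | forall b, Bset phi x b -> v 0 b = 0].

Definition gradientM phi x f u : 'rV[R]_n := proj (tangent phi x) (gradient f u).

Definition subdiffM phi x g u : set 'rV[R]_n :=
  [set v | tangent phi x v /\
     forall y, manifold phi x y -> ((dotp v (y - u)%R)%:E <= g y - g u)%E].

Definition spurious_stationary f g phi (X : set 'rV[R]_n) x : Prop :=
  [/\ X x,
      [set gradientM phi x f x + v | v in subdiffM phi x g x] 0
    & ~ [set gradient f x + v | v in subdiff g x] 0].

End SpuriousStationarity.

(* Main.v *)
(** Call [S] the set of points of [X] in the interior of [dom h].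

    Well-posedness: on [S] the objective is strictly convex and continuous, and
    it is coercive by (G4).  Near a boundary point [y] the segment towards the
    base point carries a strict decrease of the objective, because the
    derivative of the kernel blows up; convexity transfers this decrease to all
    points of [S] near [y], so a minimiser exists in [S] by compactness.

    Trapping: let [x] tend to the spurious point [p] within [S] and let [v] be
    close to some [q <> p].  If [q] leaves the manifold of [p], the
    Bregman term of [v] from [x] blows up.  Otherwise let [D] be the Bregman
    divergence of [q] from [p] over the coordinates not on the boundary.
    (G3), read on the manifold after a small perturbation towards the interior,
    and stationarity on the manifold give
    [(gamma + g)(q) >= (gamma + g)(p) - D / tbar], and [t < tbar] makes the
    objective at [v] exceed that at [x] by about [(1/t - 1/tbar) D > 0].  Hence
    no point at a small positive distance from [p] beats [x], and by convexity
    the minimiser stays close to [p].  Iterating this [K] times and starting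
    close enough to [p] gives the claim. *)

Require Import Defs.
From mathcomp Require Import all_boot all_order all_algebra.
From mathcomp Require Import all_classical all_reals all_analysis.
From mathcomp Require Import ring lra.
Import Order.TTheory GRing.Theory Num.Theory.
Import numFieldNormedType.Exports.
Local Open Scope classical_set_scope.
Local Open Scope ring_scope.
Set Implicit Arguments.
Unset Strict Implicit.
Unset Printing Implicit Defensive.

(** * First-order expansion along a ray *)

Section DirectionalExpansion.
Context {R : realType} {V : normedModType R}.

Lemma differentiable_ray (f : V -> R) (x v : V) (e : R) :
  differentiable f x -> 0 < e ->
  \forall l \near 0^'+, `|f (x + l *: v) - f x - l * 'd f x v| <= e * l.
Proof.
move=> df e0; have dv : derivable f x v by exact: diff_derivable.
have : (fun l => l^-1 *: ((f \o shift x) (l *: v) - f x)) @ 0^' --> 'D_v f x.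
  exact: dv.
move=> /cvgrPdist_le /(_ e e0); rewrite !near_withinE.
apply: filterS => l Hl l0; have := Hl (lt0r_neq0 l0).
rewrite (deriveE v df) /= [l *: v + x]addrC => H.
rewrite -(ler_pM2l (_ : 0 < l^-1)) ?invr_gt0// mulrCA mulVf ?gt_eqF// mulr1.
rewrite -[X in X * _]gtr0_norm ?invr_gt0// -normrM mulrBr mulrA mulVf ?gt_eqF//.
by rewrite mul1r distrC.
Qed.

End DirectionalExpansion.

(** * The scalar kernel: finiteness, gradient inequality, steepness at the boundary *)

Section ScalarKernel.
Context {R : realType} {n : nat} {phi : R -> \bar R} {h : 'rV[R]_n -> \bar R}.
Hypothesis K : separable_kernel phi h.

Local Notation psi := (fine \o phi).
Local Notation dpsi := (derive1 (fine \o phi)).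

Lemma kernel_dom_convex (a b l : R) : dom phi a -> dom phi b -> 0 < l < 1 ->
  dom phi (l * a + (1 - l) * b).
Proof.
move=> Da Db l01; have [->|ab] := eqVneq a b.
  by rewrite -mulrDl addrC subrK mul1r.
exact: lt_le_trans (kernel_strictly_convex K Da Db ab l01) (leey _).
Qed.

(** A value [-oo] at [c] would push the midpoint of [c] and another point of the domain strictly
    below [-oo]. *)
Lemma kernel_gtNy (a b c : R) : dom phi a -> dom phi b -> a != b ->
  (-oo < phi c)%E.
Proof.
move=> Da Db ab; rewrite ltNye; apply/eqP => phic.
have [d Dd dc] : exists2 d, dom phi d & c != d.
  by have [->|] := eqVneq c a; [exists b|exists a].
have Dc : dom phi c by rewrite /dom /= phic.
have l01 : 0 < (2^-1 : R) < 1 by lra.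
have := kernel_strictly_convex K Dc Dd dc l01.
rewrite phic mulrNy gtr0_sg ?invr_gt0// mul1e addNye.
  by rewrite ltNge leNye.
Qed.

(* Two distinct points of the domain rule out the value [-oo]; an interior
   point provides them. *)
Lemma kernel_interior_gtNy (a c : R) : (dom phi)° a -> (-oo < phi c)%E.
Proof.
move=> Ia; have Da := interior_subset Ia.
have [e /= e0 He] := (nbhs_ballP _ _).1 Ia.
apply: (@kernel_gtNy a (a + e / 2)) => //.
  by apply: He; rewrite /ball /= opprD addNKr normrN gtr0_norm; lra.
by rewrite -subr_eq0 opprD addNKr oppr_eq0; lra.
Qed.

Variable o : R.
Hypothesis Io : (dom phi)° o.

Lemma kernel_fin (a : R) : dom phi a -> phi a = (psi a)%:E.
Proof.
by move=> Da; rewrite /= fineK// fin_real// (kernel_interior_gtNy _ Io).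
Qed.

Lemma kernel_strict (a b l : R) : dom phi a -> dom phi b -> a != b ->
  0 < l < 1 -> psi (l * a + (1 - l) * b) < l * psi a + (1 - l) * psi b.
Proof.
move=> Da Db ab l01; have := kernel_strictly_convex K Da Db ab l01.
rewrite kernel_fin; last exact: kernel_dom_convex.
by rewrite (kernel_fin Da) (kernel_fin Db) -!EFinM -EFinD lte_fin.
Qed.

Lemma kernel_convex (a b l : R) : dom phi a -> dom phi b ->
  0 < l < 1 -> psi (l * a + (1 - l) * b) <= l * psi a + (1 - l) * psi b.
Proof.
move=> Da Db l01; have [->|ab] := eqVneq a b; last exact/ltW/kernel_strict.
by rewrite -!mulrDl [l + _]addrC subrK !mul1r.
Qed.

(** As [c] is only a limit of domain points, a domain point [d] close to it takes its place; every
    [r] near the target is then a convex combination of [d] and a point [q] near [m]. *)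
Lemma kernel_interior_ray (c m s : R) : closure (dom phi) c ->
  (dom phi)° m -> 0 < s <= 1 -> (dom phi)° (c + s * (m - c)).
Proof.
move=> Cc Im /andP[s0]; rewrite le_eqVlt => /predU1P[->|s1].
  by rewrite mul1r addrC subrK.
have [e /= e0 He] := (nbhs_ballP _ _).1 Im.
have se0 : 0 < s * (e / 2) by rewrite mulr_gt0// divr_gt0.
have [d [Dd /=]] := Cc _ (nbhsx_ballx c _ se0).
rewrite /ball /= => cd.
rewrite /interior; apply/nbhs_ballP; exists (s * (e / 2)) => //= r.
rewrite /ball /= => Hr.
pose q := (r - (1 - s) * d) / s.
have -> : r = s * q + (1 - s) * d by rewrite /q; field; rewrite gt_eqF.
apply: kernel_dom_convex => //; last by rewrite s0.
apply: He; rewrite /ball /=.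
have -> : m - q = ((c + s * (m - c) - r) - (1 - s) * (c - d)) / s.
  by rewrite /q; field; rewrite gt_eqF.
rewrite normrM normfV (gtr0_norm s0) ltr_pdivrMr//.
apply: le_lt_trans (ler_normB _ _) _; rewrite normrM (gtr0_norm (_ : 0 <
  1 - s)); last by lra.
have : (1 - s) * `|c - d| <= `|c - d| by have := normr_ge0 (c - d); nra.
by lra.
Qed.

Lemma kernel_grad_ge (a b : R) : (dom phi)° a -> (dom phi)° b ->
  dpsi a * (b - a) <= psi b - psi a.
Proof.
move=> Ia Ib; rewrite leNgt; apply/negP => lt.
have [_ da _] := kernel_C1 K Ia.
have dfa : differentiable psi a by apply/derivable1_diffP.
(* Half of the supposed gap: for small [l] the expansion at [a] and the chord bound from convexity
   then contradict each other. *)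
pose e := (dpsi a * (b - a) - (psi b - psi a)) / 2.
have e0 : 0 < e by rewrite /e; lra.
have H1 := differentiable_ray (b - a) dfa e0.
have H2 : \forall l \near (0 : R)^'+, 0 < l < 1.
  by near=> l; apply/andP; split; near: l;
    [exact: nbhs_right_gt|exact: nbhs_right_lt].
have [l [/= H /[dup] l01 /andP[l0 l1]]] := filter_ex (filterI H1 H2).
have := kernel_convex (interior_subset Ib) (interior_subset Ia) l01.
rewrite deriv1E// in H.
have -> : l * b + (1 - l) * a = a + l *: (b - a) by rewrite /GRing.scale /=;
  ring.
move: H; rewrite ler_norml /GRing.scale /= => /andP[H _].
rewrite /e /= in H lt * => H3.
move: l0; nra.
Unshelve. all: end_near. Qed.

(** The weak inequality is applied at the midpoint of [a] and [b], where strict convexity leaves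
    room below the chord. *)
Lemma kernel_grad_gt (a b : R) : (dom phi)° a -> (dom phi)° b -> a != b ->
  dpsi a * (b - a) < psi b - psi a.
Proof.
move=> Ia Ib ab.
have l01 : 0 < (2^-1 : R) < 1 by lra.
have s01 : 0 < (2^-1 : R) <= 1 by lra.
have := kernel_grad_ge
  Ia (kernel_interior_ray (subset_closure (interior_subset Ia)) Ib s01).
have := kernel_strict (interior_subset Ib) (interior_subset Ia) _ l01.
rewrite eq_sym => /(_ ab).
have -> : 2^-1 * b + (1 - 2^-1) * a = a + 2^-1 * (b - a) by ring.
lra.
Qed.

Lemma kernel_deriv_mono (a b : R) : (dom phi)° a -> (dom phi)° b ->
  dpsi a * (b - a) <= dpsi b * (b - a).
Proof.
move=> Ia Ib; have := kernel_grad_ge Ia Ib; have := kernel_grad_ge Ib Ia.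
nra.
Qed.

(** If this failed, interior points within [k.+1%:R^-1] of [c] with derivative bounded by [M] would
    form a sequence violating steepness. *)
Lemma kernel_steep_near (c M : R) : bd (dom phi) c ->
  \forall r \near c, (dom phi)° r -> M < `|dpsi r|.
Proof.
move=> Bc; apply: contrapT => notnear.
have bad (k : nat) : exists r, [/\ `|c - r| < k.+1%:R^-1,
  (dom phi)° r & `|dpsi r| <= M].
  apply: contrapT => noex; apply: notnear.
  apply/nbhs_ballP; exists k.+1%:R^-1 => /=; first by rewrite invr_gt0.
  move=> r cr Ir; rewrite ltNge; apply/negP => le.
  by apply: noex; exists r.
have [u Hu] := choice bad.
have uc : u @ \oo --> c.
  apply/cvgrPdist_lt => e e0; near=> k.
  have [H _ _] := Hu k; apply: lt_trans H _.
  near: k; exact: near_infty_natSinv_lt (PosNum e0).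
have := kernel_steep K (fun k => let: And3 _ H _ := Hu k in H) Bc uc.
move=> /cvgryPgt /(_ M) /filter_ex [k].
by have [_ _] := Hu k; rewrite leNgt => /negP.
Unshelve. all: end_near. Qed.

(** Steepness controls only the size of the derivative. Its sign comes from monotonicity: near [c],
    the derivative in the direction of [m] stays below the one at [m], so it can only tend to
    [-oo]. *)
Lemma kernel_steep_dir (c m M : R) : bd (dom phi) c -> (dom phi)° m ->
  \forall r \near c, (dom phi)° r -> dpsi r * (m - c) < M.
Proof.
move=> Bc Im.
have mc : m != c by apply/eqP => mc; move: Bc; rewrite -mc => -[].
have d0 : 0 < `|m - c| by rewrite normr_gt0 subr_eq0.
(* Beyond [N], the excess of [|dpsi r|] over [|dpsi m|], multiplied by [|m - c|], is larger than
   [|M|]. *)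
pose N := `|dpsi m| + `|M| / `|m - c|.
near=> r => Ir.
have Nr : N < `|dpsi r| by apply: (near (kernel_steep_near N Bc)).
have rc : `|c - r| < `|m - c|.
  by near: r; apply: nbhs_ball_norm (PosNum d0).
have mono := kernel_deriv_mono Ir Im.
have MN : `|M| < (`|dpsi r| - `|dpsi m|) * `|m - c|.
  by rewrite -ltr_pdivrMr// ltrBrDl.
have M0 := ler_norm M; have MM := ler_norm (- M); rewrite normrN in MM.
have P1 : `|dpsi m| * `|m - c| >= 0 by rewrite mulr_ge0.
have [mc0|mc0] := ltP 0 (m - c).
  rewrite (gtr0_norm mc0) in rc MN P1.
  have mr0 : 0 < m - r by move: rc; rewrite ltr_norml; lra.
  have dd : dpsi r <= dpsi m by rewrite -(ler_pM2r mr0).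
  have : dpsi r < 0.
    rewrite ltNge; apply/negP => r0; move: dd MN; rewrite (ger0_norm r0).
    move=> dd; have := ler_norm (dpsi m); nra.
  move=> r0; rewrite (ltr0_norm r0) in MN; nra.
have {}mc0 : m - c < 0 by rewrite lt_neqAle mc0 subr_eq0 mc.
rewrite (ltr0_norm mc0) in rc MN P1.
have mr0 : m - r < 0 by move: rc; rewrite ltr_norml; lra.
have dd : dpsi m <= dpsi r by rewrite -(ler_nM2r mr0).
have : 0 < dpsi r.
  rewrite ltNge; apply/negP => r0; move: dd MN; rewrite (ler0_norm r0).
  move=> dd; have := ler_norm (- dpsi m); rewrite normrN; nra.
move=> r0; rewrite (gtr0_norm r0) in MN; nra.
Unshelve. all: end_near. Qed.

End ScalarKernel.

(** * The separable kernel and its Bregman divergence, coordinate by coordinate *)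

Definition scalar_bregman {R : realType} (phi : R -> \bar R) (b a : R) : R :=
  fine (phi b) - fine (phi a) - derive1 (fine \o phi) a * (b - a).

Section SeparableKernel.
Context {R : realType} {n : nat} {phi : R -> \bar R} {h : 'rV[R]_n -> \bar R}.
Hypothesis K : separable_kernel phi h.

Local Notation psi := (fine \o phi).
Local Notation dpsi := (derive1 (fine \o phi)).

Lemma near_coord (x : 'rV[R]_n) (i : 'I_n) (P : set R) :
  nbhs (x 0 i) P -> \forall y \near x, P ((y : 'rV[R]_n) 0 i).
Proof. exact: coord_continuous. Qed.

Variable w : 'rV[R]_n.
Hypothesis Iw : (dom h)° w.

Lemma near_shift_dom : \forall c \near (0 : R), dom h (w + const_mx c).
Proof.
have /nbhs_ballP[e /= e0 He] := Iw.
apply/nbhs_ballP; exists e => //= c; rewrite /ball /= sub0r normrN => ce.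
apply: He; split => [|i j]; [by []|]; rewrite !mxE /ball /= opprD addNKr normrN.
exact: ce.
Qed.

(* If [phi] took the value [-oo] somewhere, its domain would be a single point
   and a small diagonal shift of [w] would leave the domain of [h]. *)
Lemma separable_gtNy (i : 'I_n) (c : R) : (-oo < phi c)%E.
Proof.
rewrite ltNye; apply/eqP => phic.
have single r : r != c -> phi r = +oo%E.
  move=> rc; apply/eqP/negP => /negP; rewrite -ltey => Dr.
  have Dc : dom phi c by rewrite /dom /= phic.
  by have := kernel_gtNy K c Dr Dc rc; rewrite phic.
have H1 : \forall s \near (0 : R)^'+, dom h (w + const_mx s).
  rewrite near_withinE; apply: filterS near_shift_dom => s Hs _; exact: Hs.
have H2 : \forall s \near (0 : R)^'+, forall j, w 0 j + s != c.
  apply: filter_forall => j; have [wc|wc] := ltP (w 0 j) c.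
    near=> s; rewrite lt_eqF// -ltrBrDl; near: s; apply: nbhs_right_lt.
    by rewrite subr_gt0.
  near=> s; rewrite gt_eqF// -ltrBlDl.
  by apply: (@le_lt_trans _ _ 0); [lra|near: s; exact: nbhs_right_gt].
have [s [Hs1 Hs2]] := filter_ex (filterI H1 H2).
have phis j : phi ((w + const_mx s) 0 j) = +oo%E by rewrite single ?mxE.
move: Hs1; rewrite /dom /= (kernel_sum K) (_ : bigop _ _ _ = +oo%E)//.
apply/esum_eqyP => [j _|]; first by rewrite phis.
by exists i; rewrite mem_index_enum.
Unshelve. all: end_near. Qed.

(** One coordinate with value [+oo] makes the whole sum [+oo] because [separable_gtNy] excludes
    [-oo] from the other coordinates. *)
Lemma dom_hP (y : 'rV[R]_n) : dom h y <-> forall i, dom phi (y 0 i).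
Proof.
split => [Dy i|Dy]; last first.
  by rewrite /dom /= (kernel_sum K); apply: lte_sum_pinfty => i _; exact: Dy.
rewrite /dom /= ltey; apply/eqP => phii.
move: Dy; rewrite /dom /= (kernel_sum K).
suff -> : (\sum_(j < n) phi (y 0%R j))%E = +oo%E by [].
apply/esum_eqyP => [j _|]; first by rewrite -ltNye (separable_gtNy i).
by exists i; rewrite mem_index_enum.
Qed.

Lemma dom_interior_coord (y : 'rV[R]_n) : (dom h)° y ->
  forall i, (dom phi)° (y 0 i).
Proof.
move=> /nbhs_ballP[e /= e0 He] i.
apply/nbhs_ballP; exists e => //= r yr.
have : dom h (y + const_mx (r - y 0 i)).
  apply: He; split => [|i' j]; [by []|];
    rewrite !mxE /ball /= opprD addNKr normrN.
  by rewrite distrC.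
by move=> /dom_hP/(_ i); rewrite !mxE addrC subrK.
Qed.

Lemma dom_interiorP (y : 'rV[R]_n) :
  (dom h)° y <-> forall i, (dom phi)° (y 0 i).
Proof.
split; first exact: dom_interior_coord.
move=> Iy.
pose P i (z : 'rV[R]_n) := dom phi (z 0 i).
have : nbhs y (fun z => forall i, P i z).
  refine (@filter_forall _ _ P (nbhs y) _ _) => i.
  exact: (@near_coord y i (dom phi) (Iy i)).
by apply: filterS => z Dz; apply/dom_hP.
Qed.

Lemma kernel_point (i : 'I_n) : (dom phi)° (w 0 i).
Proof. exact: dom_interior_coord. Qed.

Lemma closure_dom_coord (y : 'rV[R]_n) : closure (dom h) y ->
  forall i, closure (dom phi) (y 0 i).
Proof.
move=> Cy i U /near_coord /Cy [z [/dom_hP Dz Uz]].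
by exists (z 0 i).
Qed.

Lemma dom_interior_ray (y m : 'rV[R]_n) (s : R) : closure (dom h) y ->
  (dom h)° m -> 0 < s <= 1 -> (dom h)° (y + s *: (m - y)).
Proof.
move=> Cy Im s01; apply/dom_interiorP => i; rewrite !mxE.
exact: (kernel_interior_ray K (@closure_dom_coord _ Cy i)
  (dom_interior_coord Im i) s01).
Qed.

Lemma kernel_sum_fin (y : 'rV[R]_n) : dom h y ->
  h y = (\sum_(i < n) psi (y 0 i))%:E.
Proof.
move=> /dom_hP Dy; rewrite (kernel_sum K) -sumEFin; apply: eq_bigr => i _.
exact: (kernel_fin K (kernel_point i) (Dy i)).
Qed.

Lemma gradient_kernel (x : 'rV[R]_n) : (dom h)° x ->
  gradient (fine \o h) x = \row_i dpsi (x 0 i).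
Proof.
move=> Ix; apply/rowP => i; rewrite !mxE.
have Ixi := dom_interior_coord Ix i.
have [_ dx _] := kernel_C1 K Ixi.
have : (fun l => l^-1 *: ((psi \o shift (x 0 i)) (l *: 1) - psi (x 0 i))) @ 0^'
         --> dpsi (x 0 i).
  by rewrite derive1E; exact: dx.
move=> dxi; rewrite /derive; refine (cvg_lim (@Rhausdorff R) _).
apply: cvg_trans dxi; apply: near_eq_cvg.
near=> l; congr (_ *: _).
(* [fine] splits over the coordinate sum at points of [dom h], so the shifted point is first placed
   there; the other coordinates then cancel. *)
have Dl : dom phi (x 0 i + l).
  near: l; apply: nbhs_dnbhs; move: Ixi => /nbhs_ballP[e /= e0 He].
  apply/nbhs_ballP; exists e => //= l; rewrite /ball /= sub0r normrN => le.
  by apply: He; rewrite /ball /= opprD addNKr normrN.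
have Dx : dom h x by exact: interior_subset.
have Dxl : dom h (l *: delta_mx 0 i + x).
  apply/dom_hP => j; rewrite !mxE eqxx /=; have [->|_] := eqVneq j i.
    by rewrite mulr1 addrC.
  by rewrite mulr0 add0r; apply: (iffLR (dom_hP x)) => //.
rewrite /= kernel_sum_fin// (kernel_sum_fin Dx) /= -sumrB (bigD1 i)//= big1.
  by rewrite !mxE !eqxx /= [l *: 1]mulr1 mulr1 addr0.
by move=> j ji; rewrite !mxE eqxx (negPf ji) mulr0 add0r subrr.
Unshelve. all: end_near. Qed.

Lemma bregman_fin (y x : 'rV[R]_n) : dom h y -> (dom h)° x ->
  bregman h y x = (\sum_(i < n) scalar_bregman phi (y 0 i) (x 0 i))%:E.
Proof.
move=> Dy Ix; rewrite /bregman kernel_sum_fin// kernel_sum_fin;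
  last exact: interior_subset.
rewrite -!EFinB gradient_kernel// /dotp -!sumrB; congr (_%:E).
by apply: eq_bigr => i _; rewrite !mxE.
Qed.

Lemma bregman_pinfty (y x : 'rV[R]_n) : ~ dom h y -> (dom h)° x ->
  bregman h y x = +oo%E.
Proof.
move=> /negP; rewrite -leNgt leye_eq => /eqP hy Ix.
by rewrite /bregman hy (kernel_sum_fin (interior_subset Ix)).
Qed.

Lemma scalar_bregman_ge0 (i : 'I_n) (b a : R) :
  (dom phi)° b -> (dom phi)° a -> 0 <= scalar_bregman phi b a.
Proof.
by move=> Ib Ia; rewrite subr_ge0; apply: (kernel_grad_ge K (kernel_point i)).
Qed.

Lemma scalar_bregman_gt0 (i : 'I_n) (b a : R) :
  (dom phi)° b -> (dom phi)° a -> b != a -> 0 < scalar_bregman phi b a.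
Proof.
move=> Ib Ia ba; rewrite subr_gt0.
by apply: (kernel_grad_gt K (kernel_point i)) => //; rewrite eq_sym.
Qed.

End SeparableKernel.

(** * The subproblem in real-valued form: convexity and continuity *)

Section Subproblem.
Context {R : realType} {n : nat}.
Variables (f : 'rV[R]_n -> R) (g h : 'rV[R]_n -> \bar R) (phi : R -> \bar R).
Variables (gamma : 'rV[R]_n -> 'rV[R]_n -> R) (X : set 'rV[R]_n) (tbar t : R).
Hypothesis hP : problem_assumptions f g phi h X.
Hypothesis hG : surrogate_assumptions f g h X gamma tbar.
Hypothesis ht : 0 < t < tbar.

Let K := h_kernel hP.
Local Notation psi := (fine \o phi).
Local Notation dpsi := (derive1 (fine \o phi)).
Local Notation S := ((dom h)° `&` X).

Variable w : 'rV[R]_n.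
Hypothesis Sw : S w.

Definition model (x y : 'rV[R]_n) : R := gamma y x + fine (g y).

(** Real-valued form of [subproblem], equal to it for [x] in [S] and [y] in both [X] and [dom h].
    The base point [x] comes first here. *)
Definition objective (x y : 'rV[R]_n) : R :=
  model x y + t^-1 * \sum_(i < n) scalar_bregman phi (y 0 i) (x 0 i).

Let t_gt0 : 0 < t. Proof. by case/andP: ht. Qed.
Let tbar_gt0 : 0 < tbar. Proof. by case/andP: ht; lra. Qed.

Lemma domgP (y : 'rV[R]_n) : X y <-> (g y < +oo)%E.
Proof. by rewrite -(X_dom hP). Qed.

Lemma g_fin (y : 'rV[R]_n) : X y -> g y = (fine (g y))%:E.
Proof. by move=> Xy; rewrite fineK//; case: (g_convex_lip hP) => _ + _;
  exact. Qed.

Lemma X_conv (p q : 'rV[R]_n) (l : R) : X p -> X q -> 0 < l < 1 ->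
  X (l *: p + (1 - l) *: q).
Proof.
move=> Xp Xq l01; have [cg _ _] := g_convex_lip hP.
have /domgP Dp := Xp; have /domgP Dq := Xq.
apply/domgP; apply: le_lt_trans (cg _ _ _ Dp Dq l01) _.
by rewrite (g_fin Xp) (g_fin Xq) ltey.
Qed.

Lemma g_conv (p q : 'rV[R]_n) (l : R) : X p -> X q -> 0 < l < 1 ->
  fine (g (l *: p + (1 - l) *: q)) <= l * fine (g p) + (1 - l) * fine (g q).
Proof.
move=> Xp Xq l01; have [cg _ _] := g_convex_lip hP.
have /domgP Dp := Xp; have /domgP Dq := Xq.
have := cg _ _ _ Dp Dq l01.
by rewrite (g_fin (X_conv Xp Xq l01)) (g_fin Xp) (g_fin Xq)
  -!EFinM -EFinD lee_fin.
Qed.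

(** Limits as [s] tends to [0] use the left form, convexity the right one. *)
Lemma rayE (y m : 'rV[R]_n) (s : R) :
  y + s *: (m - y) = s *: m + (1 - s) *: y.
Proof. by rewrite scalerBr scalerBl scale1r addrCA. Qed.

Lemma X_ray (y m : 'rV[R]_n) (s : R) : X y -> X m -> 0 < s <= 1 ->
  X (y + s *: (m - y)).
Proof.
move=> Xy Xm /andP[s0]; rewrite le_eqVlt => /predU1P[->|s1].
  by rewrite scale1r addrC subrK.
by rewrite rayE; apply: X_conv => //; rewrite s0.
Qed.

(** [X] lies in the closure of [dom h], so any step towards a point of [S] enters the interior. This
    is how points of [X] are approximated from within [S]. *)
Lemma S_ray (y m : 'rV[R]_n) (s : R) : X y -> S m -> 0 < s <= 1 ->
  S (y + s *: (m - y)).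
Proof.
move=> Xy [Im Xm] s01; split; last exact: X_ray.
by apply: (dom_interior_ray K Sw.1) => //; case: (X_domh hP) => _; apply.
Qed.

Lemma dom_h_conv (p q : 'rV[R]_n) (l : R) : dom h p -> dom h q -> 0 < l < 1 ->
  dom h (l *: p + (1 - l) *: q).
Proof.
move=> /(dom_hP K Sw.1) Dp /(dom_hP K Sw.1) Dq l01; apply/(dom_hP K Sw.1) => i.
by rewrite !mxE; apply: (kernel_dom_convex K).
Qed.

Lemma subproblem_fin (x y : 'rV[R]_n) : S x -> X y -> dom h y ->
  subproblem gamma g h t y x = (objective x y)%:E.
Proof.
move=> [Ix Xx] Xy Dy.
by rewrite /subproblem (g_fin Xy) (bregman_fin K Sw.1)// -EFinD -EFinM -EFinD.
Qed.

Lemma subproblem_pinfty (x y : 'rV[R]_n) : S x -> ~ (X y /\ dom h y) ->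
  subproblem gamma g h t y x = +oo%E.
Proof.
move=> [Ix Xx] nD; rewrite /subproblem.
have g_gtNy : (-oo < g y)%E.
  have [Xy|] := pselect (X y); first by rewrite (g_fin Xy) ltNyr.
  by move=> /domgP/negP; rewrite -leNgt leye_eq => /eqP ->.
have [Dy|nDy] := pselect (dom h y).
  have nX : ~ X y by move=> Xy; apply: nD.
  move: nX => /domgP/negP; rewrite -leNgt leye_eq => /eqP ->.
  by rewrite (bregman_fin K Sw.1)// -EFinM addye.
rewrite (bregman_pinfty K Sw.1)// mulry gtr0_sg ?invr_gt0// mul1e addey//.
by case: (g y) g_gtNy => //; rewrite ltxx.
Qed.

Lemma kernel_sum_conv (p q : 'rV[R]_n) (l : R) : dom h p -> dom h q ->
  0 < l < 1 -> \sum_(i < n) psi ((l *: p + (1 - l) *: q) 0 i) <=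
    l * \sum_(i < n) psi (p 0 i) + (1 - l) * \sum_(i < n) psi (q 0 i).
Proof.
move=> Dp Dq l01; rewrite !mulr_sumr -big_split /=.
apply: ler_sum => i _; rewrite !mxE.
by apply: (kernel_convex K (kernel_point K Sw.1 i)) => //; move: i;
  apply/(dom_hP K Sw.1).
Qed.

Lemma surrogate_strict (x p q : 'rV[R]_n) (l : R) :
  X x -> X p -> dom h p -> X q -> dom h q -> p != q -> 0 < l < 1 ->
  tbar * model x (l *: p + (1 - l) *: q) +
    \sum_(i < n) psi ((l *: p + (1 - l) *: q) 0 i) <
  l * (tbar * model x p + \sum_(i < n) psi (p 0 i)) +
    (1 - l) * (tbar * model x q + \sum_(i < n) psi (q 0 i)).
Proof.
move=> Xx Xp Dp Xq Dq pq l01.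
have [_ /(_ x Xx) sc] := gamma_strictly_convex hG.
have Xu := X_conv Xp Xq l01; have Du := dom_h_conv Dp Dq l01.
have E y : X y -> dom h y ->
    (tbar%:E * ((gamma y x)%:E + g y) + h y)%E =
    (tbar * model x y + \sum_(i < n) psi (y 0 i))%:E.
  by move=> Xy Dy; rewrite (g_fin Xy)
    (kernel_sum_fin K Sw.1)// -EFinD -EFinM -EFinD.
have := sc p q l _ _ pq l01.
by rewrite /dom /= !E// -!EFinM -EFinD lte_fin => /(_ (ltey _) (ltey _)).
Qed.

(* The part of the objective beyond a multiple of the strictly convex function
   of (G3) is [(1/t - 1/tbar) h] plus an affine function. *)
Lemma objective_strict (x p q : 'rV[R]_n) (l : R) :
  X x -> X p -> dom h p -> X q -> dom h q -> p != q -> 0 < l < 1 ->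
  objective x (l *: p + (1 - l) *: q) <
  l * objective x p + (1 - l) * objective x q.
Proof.
move=> Xx Xp Dp Xq Dq pq l01.
have Hs := surrogate_strict Xx Xp Dp Xq Dq pq l01.
have Hc := kernel_sum_conv Dp Dq l01.
have BE y : \sum_(i < n) scalar_bregman phi (y 0 i) (x 0 i) =
   \sum_(i < n) psi (y 0 i) - (\sum_(i < n) dpsi (x 0 i) * y 0 i +
   \sum_(i < n) (psi (x 0 i) - dpsi (x 0 i) * x 0 i)).
  rewrite -big_split -sumrB /=; apply: eq_bigr => i _.
  by rewrite /scalar_bregman /=; ring.
have Hl : \sum_(i < n) dpsi (x 0 i) * (l *: p + (1 - l) *: q) 0 i =
   l * \sum_(i < n) dpsi (x 0 i) * p 0 i +
   (1 - l) * \sum_(i < n) dpsi (x 0 i) * q 0 i.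
  rewrite !mulr_sumr -big_split /=; apply: eq_bigr => i _.
  by rewrite !mxE; ring.
rewrite /objective !BE Hl; move: Hc Hs; clear BE Hl.
move: (\sum_(i < n) _) (\sum_(i < n) _) (\sum_(i < n) _) (\sum_(i < n) _)
  (\sum_(i < n) _) (\sum_(i < n) _).
move: (model x _) (model x p) (model x q) => a b c L0 Lq Lp Hq Hp Hu Hc Hs.
have c1 : 0 < t^-1 - tbar^-1.
  by rewrite subr_gt0 ltf_pV2 ?posrE//; case/andP: ht.
have c2 : 0 < tbar^-1 by rewrite invr_gt0.
have Hs' : a + tbar^-1 * Hu < l * (b + tbar^-1 * Hp) + (1 - l)
  * (c + tbar^-1 * Hq).
  have E z H : z + tbar^-1 * H = tbar^-1 * (tbar * z + H).
    by rewrite mulrDr mulKf ?gt_eqF.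
  rewrite !E (mulrCA l) (mulrCA (1 - l)) -mulrDr ltr_pM2l//.
have := ler_wpM2l (ltW c1) Hc; lra.
Qed.

Lemma objective_conv (x p q : 'rV[R]_n) (l : R) :
  X x -> X p -> dom h p -> X q -> dom h q -> 0 < l < 1 ->
  objective x (l *: p + (1 - l) *: q) <=
  l * objective x p + (1 - l) * objective x q.
Proof.
move=> Xx Xp Dp Xq Dq l01; have [<-|pq] := eqVneq p q.
  by rewrite -scalerDl -mulrDl addrC subrK scale1r mul1r.
exact/ltW/objective_strict.
Qed.

(** The Lipschitz bound holds for pairs near [(y, y)]; fixing the second point at [y] gives
    continuity. *)
Lemma g_continuous (y : 'rV[R]_n) : X y ->
  fine (g z) @[z --> within X (nbhs y)] --> fine (g y).
Proof.
move=> Xy; have [_ _ lip] := g_convex_lip hP.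
have /(_ (y, y)) := lip; rewrite /lipschitz_on => /(_ (conj Xy Xy)) lipy.
have [M [M0 HM]] : exists M : R, 0 < M /\
    \forall p \near within (X `*` X) (nbhs (y, y)),
      `|fine (g p.1) - fine (g p.2)| <= M * `|p.1 - p.2|.
  have [M [HM M0]] := filter_ex (filterI lipy (nbhs_pinfty_gt (real0 _))).
  by exists M; split.
move: HM; rewrite near_withinE => -[[U V] /= [Uy Vy] HUV].
apply/cvgrPdist_le => e e0; rewrite near_withinE.
near=> z => Xz.
have /= := HUV (z, y) (conj _ (nbhs_singleton Vy)) (conj Xz Xy).
rewrite distrC => /(_ _)/le_trans; apply.
  by near: z.
rewrite -ler_pdivlMl// mulrC distrC; near: z.
by apply: cvgr_dist_le; [exact: cvg_id|rewrite divr_gt0].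
Unshelve. all: end_near. Qed.

Lemma scalar_bregman_continuous (a b : R) : (dom phi)° b ->
  {for b, continuous (scalar_bregman phi ^~ a)}.
Proof.
move=> Ib; have [_ db _] := kernel_C1 K Ib.
have cb : {for b, continuous psi}.
  by apply/differentiable_continuous/derivable1_diffP.
rewrite /scalar_bregman /prop_for /continuous_at.
apply: cvgB; first by apply: cvgB; [exact: cb|exact: cvg_cst].
by apply: cvgM; [exact: cvg_cst|apply: cvgB; [exact: cvg_id|exact: cvg_cst]].
Qed.

Lemma model_continuous (x y : 'rV[R]_n) : X x -> X y ->
  model x z @[z --> within X (nbhs y)] --> model x y.
Proof.
move=> Xx Xy; apply: cvgD; last exact: g_continuous.
have [_ /(_ y x Xy Xx) dy _] := gamma_C1 hG.
apply: cvg_within_filter; exact: differentiable_continuous dy.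
Qed.

Lemma objective_continuous (x y : 'rV[R]_n) : X x -> S y ->
  objective x z @[z --> within X (nbhs y)] --> objective x y.
Proof.
move=> Xx [Iy Xy]; apply: cvgD; first exact: model_continuous.
apply: cvg_within_filter; apply: cvgM; first exact: cvg_cst.
apply: cvg_big => [|i _]; first exact: add_continuous.
apply: (cvg_comp (fun z : 'rV[R]_n => z 0 i) (scalar_bregman phi ^~ (x 0 i))).
  exact: coord_continuous.
exact/scalar_bregman_continuous/(dom_interior_coord K Sw.1).
Qed.

Lemma model_near (x y : 'rV[R]_n) (e : R) : X x -> X y -> 0 < e ->
  \forall z \near y, X z -> `|model x y - model x z| < e.
Proof.
move=> Xx Xy e0; have := @model_continuous x y Xx Xy.
by move=> /cvgrPdist_lt/(_ e e0).
Qed.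

Lemma objective_near (x y : 'rV[R]_n) (e : R) : X x -> S y -> 0 < e ->
  \forall z \near y, X z -> `|objective x y - objective x z| < e.
Proof.
move=> Xx Sy e0; have := @objective_continuous x y Xx Sy.
by move=> /cvgrPdist_lt/(_ e e0).
Qed.

End Subproblem.

(** * Limits along rays *)

Section Rays.
Context {R : realType} {V : normedModType R}.

Lemma near_ray (y v : V) (P : set V) : nbhs y P ->
  \forall s \near (0 : R)^'+, P (y + s *: v).
Proof.
move=> Py; have : (fun s : R => y + s *: v) @ 0^'+ --> y + (0 : R) *: v.
  apply: cvg_within_filter; apply: cvgD; first exact: cvg_cst.
  by apply: cvgZr_tmp; exact: cvg_id.
by rewrite scale0r addr0; apply.
Qed.

Lemma ray_cvg (m y : V) (s : R) :
  (fun y' => y' + s *: (m - y')) @ y --> y + s *: (m - y).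
Proof.
apply: cvgD; first exact: cvg_id.
by apply: cvgZ; [exact: cvg_cst|apply: cvgB; [exact: cvg_cst|exact: cvg_id]].
Qed.

Lemma continuous_norm_sub (a : V) : continuous (fun v => `|v - a|).
Proof.
by move=> v; apply: cvg_norm; apply: cvgB; [exact: cvg_id|exact: cvg_cst].
Qed.

End Rays.

(** * The sup norm against the Euclidean norm *)

Section Norms.
Context {R : realType} {n : nat}.
Implicit Types u v : 'rV[R]_n.

Lemma normr_leP u (c : R) : 0 <= c ->
  (forall i, `|u 0 i| <= c) -> `|u| <= c.
Proof.
move=> c0 uc; rewrite /Num.Def.normr /= mx_normrE.
by apply: bigmax_le => // -[i j] _ /=; rewrite (ord1 i).
Qed.

Lemma coord_le_normr u i : `|u 0 i| <= `|u|.
Proof.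
rewrite [leRHS]/Num.Def.normr /= mx_normrE.
by apply: (le_bigmax _ (fun ij : 'I_1 * 'I_n => `|u ij.1 ij.2|) (0, i)).
Qed.

Lemma normr_le_norm2 u : `|u| <= norm2 u.
Proof.
apply: normr_leP => [|i]; first exact: sqrtr_ge0.
rewrite -sqrtr_sqr ler_wsqrtr// /dotp (bigD1 i)//= -expr2 lerDl.
by apply: sumr_ge0 => j _; rewrite -expr2 sqr_ge0.
Qed.

Lemma norm2_le_normr u : norm2 u <= n%:R * `|u|.
Proof.
rewrite -[leRHS]ger0_norm ?mulr_ge0// -sqrtr_sqr ler_wsqrtr//.
apply: (@le_trans _ _ (\sum_(i < n) `|u| ^+ 2)).
  apply: ler_sum => i _; rewrite -expr2 -real_normK ?num_real//.
  by rewrite lerXn2r ?nnegrE// coord_le_normr.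
rewrite sumr_const card_ord exprMn -[leLHS]mulr_natl ler_wpM2r ?sqr_ge0//.
by rewrite -natrX ler_nat; case: (n) => // k; rewrite expnS expn1 leq_pmulr.
Qed.

End Norms.

(** Suppose there is no minimum. Near each point of [C], all points of [S] are then beaten by one
    point of [S], and compactness gives a single level that beats all of [S] in [C]. A point of [S]
    at that level or lower, and no worse than [w], can lie neither in [C] nor outside it. *)
Lemma compact_local_min {R : realType} (T : topologicalType) (S C : set T)
    (F : T -> R) (w : T) : compact C -> S w ->
  (forall y, S y -> ~ C y -> F w < F y) ->
  (forall y, C y -> (forall z, S z -> exists2 z', S z' & F z' < F z) ->
     exists2 z, S z & \forall y' \near y, S y' -> F z < F y') ->
  exists2 y, S y & forall z, S z -> F y <= F z.
Proof.
move=> cC Sw out loc; apply: contrapT => nomin.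
have dec z : S z -> exists2 z', S z' & F z' < F z.
  move=> Sz; apply: contrapT => nz; apply: nomin; exists z => // z' Sz'.
  by rewrite leNgt; apply/negP => lt; apply: nz; exists z'.
(* Sublevel sets of [F] within [S]: what holds eventually along [G] holds at every point of [S]
   whose value is low enough. *)
pose G := filter_from S (fun z0 => [set z | S z /\ F z <= F z0]).
have FG : Filter G.
  apply: filter_from_filter; first by exists w.
  move=> i j Si Sj; have [ij|ji] := leP (F i) (F j).
    by exists i => // z [Sz zi]; split; split => //; apply: le_trans ij.
  by exists j => // z [Sz zj]; split; split => //; apply: le_trans (ltW ji).
have /compact_near_coveringP/(_ T G (fun z y => S y -> F z < F y) FG) := cC.
case=> [y Cy|z0 Sz0 Hz0].
  have [z Sz Hz] := loc y Cy dec.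
  exists ([set y' | S y' -> F z < F y'], [set z' | S z' /\ F z' <= F z]).
    by split => //=; exists z.
  by move=> [y' z'] /= [Hy' [Sz' zz']] Sy'; apply: le_lt_trans zz' (Hy' Sy').
have [z1 Sz1 [z10 z1w]] : exists2 z1, S z1 & F z1 <= F z0 /\ F z1 <= F w.
  have [le|lt] := leP (F z0) (F w); first by exists z0.
  by exists w => //; split => //; apply: ltW.
have [Cz1|nCz1] := pselect (C z1).
  by have := Hz0 z1 (conj Sz1 z10) z1 Cz1 Sz1; rewrite ltxx.
by have := out z1 Sz1 nCz1; rewrite ltNge z1w.
Qed.

(** * Existence and uniqueness of the minimiser in [S] *)

Section Existence.
Context {R : realType} {n : nat}.
Variables (f : 'rV[R]_n -> R) (g h : 'rV[R]_n -> \bar R) (phi : R -> \bar R).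
Variables (gamma : 'rV[R]_n -> 'rV[R]_n -> R) (X : set 'rV[R]_n) (tbar t : R).
Hypothesis hP : problem_assumptions f g phi h X.
Hypothesis hG : surrogate_assumptions f g h X gamma tbar.
Hypothesis ht : 0 < t < tbar.

Let K := h_kernel hP.
Local Notation psi := (fine \o phi).
Local Notation dpsi := (derive1 (fine \o phi)).
Local Notation S := ((dom h)° `&` X).
Local Notation model := (model g gamma).
Local Notation objective := (objective g phi gamma t).

Let t_gt0 : 0 < t. Proof. by case/andP: ht. Qed.

Lemma near_ray_within (y m : 'rV[R]_n) (P : set 'rV[R]_n) : X y -> X m ->
  within X (nbhs y) P -> \forall s \near (0 : R)^'+, P (y + s *: (m - y)).
Proof.
move=> Xy Xm; rewrite /within /= => /(near_ray (m - y)) Py.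
near=> s; apply: (near Py s) => //; apply: (X_ray hP) => //.
apply/andP; split; near: s; first exact: nbhs_right_gt.
exact: nbhs_right_le.
Unshelve. all: end_near. Qed.

Lemma near_ray_base (y m : 'rV[R]_n) (s : R) (P : set 'rV[R]_n) : X m ->
  0 < s <= 1 -> within X (nbhs (y + s *: (m - y))) P ->
  \forall y' \near y, X y' -> P (y' + s *: (m - y')).
Proof.
move=> Xm s01 Py.
refine (@filterS _ (nbhs y) _ _ _ _ (@ray_cvg _ _ m y s _ Py)) => y' Py' Xy'.
by apply: Py'; exact: (X_ray hP).
Qed.

(** This is the gradient inequality at [u'], with the slope shifted by the linear term at [x]; it
    bounds the change of the Bregman term along a segment. *)
Lemma kernel_secant (x u u' : R) (i : 'I_n) (w : 'rV[R]_n) : S w ->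
  (dom phi)° u -> (dom phi)° u' ->
  scalar_bregman phi u' x - scalar_bregman phi u x <=
  (dpsi u' - dpsi x) * (u' - u).
Proof.
move=> Sw Iu Iu'; have := kernel_grad_ge K (kernel_point K Sw.1 i) Iu' Iu.
rewrite /scalar_bregman /=; lra.
Qed.

(** Along the segment from [y] to [x] the model grows at a bounded rate, while the Bregman term of a
    boundary coordinate falls arbitrarily fast near [y] and the other coordinates do not
    increase. *)
Lemma objective_descent_at_boundary (x y : 'rV[R]_n) : S x -> X y ->
  ~ (dom h)° y ->
  exists s s' : R, [/\ 0 < s, s < s', s' < 1 &
    objective x (y + s' *: (x - y)) < objective x (y + s *: (x - y))].
Proof.
move=> Sx Xy nIy; have [Ix Xx] := Sx.
have Cy : closure (dom h) y by case: (X_domh hP) => _; exact.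
have [i Bi] : exists i, bd (dom phi) (y 0 i).
  apply: contrapT => nB; apply: nIy; apply/(dom_interiorP K Ix) => i.
  apply: contrapT => nI; apply: nB; exists i; split => //.
  exact: (@closure_dom_coord _ _ _ _ K _ Ix _ Cy).
have [_ /(_ y x Xy Xx) dy _] := gamma_C1 hG.
set v := x - y.
(* [L] bounds the growth rate of the model: the derivative of [gamma], an error [1], and the chord
   slope of [g]. The factor [t] in [N] offsets [t^-1], and the final [1] is the net rate of
   descent. *)
pose L := 'd (gamma ^~ x) y v + 1 + (fine (g x) - fine (g y)).
pose N := t * (`|L| + 1).
have Hg : \forall s \near (0 : R)^'+,
    model x (y + s *: v) - model x y <= s * L.
  near=> s.
  have s01 : 0 < s < 1.
    by apply/andP; split; near: s; [exact: nbhs_right_gt|exact: nbhs_right_lt].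
  have := g_conv hP Xx Xy s01; rewrite -rayE -/v.
  have : `|gamma (y + s *: v) x - gamma y x - s * 'd (gamma ^~ x) y v| <= 1 * s.
    by near: s; exact: differentiable_ray.
  rewrite ler_norml /L => /andP[_ H1 H2].
  by rewrite /model; lra.
have Hi : \forall s \near (0 : R)^'+,
    (dom phi)° ((y + s *: v) 0 i) ->
    dpsi ((y + s *: v) 0 i) * (x 0 i - y 0 i) < dpsi (x 0 i) * (x 0 i - y 0 i)
      - N.
  pose P r := (dom phi)° r -> dpsi r * (x 0 i - y 0 i) < dpsi (x 0 i)
    * (x 0 i - y 0 i) - N.
  have HP : nbhs (y 0 i) P.
    exact: (kernel_steep_dir K (kernel_point K Ix i)
      _ Bi (dom_interior_coord K Ix Ix i)).
  exact: (near_ray v (near_coord HP)).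
have [s' [[/= Hg' Hi'] /andP[s'0 s'1]]] : exists s' : R,
   (model x (y + s' *: v) - model x y <= s' * L /\
   ((dom phi)° ((y + s' *: v) 0 i) ->
    dpsi ((y + s' *: v) 0 i) * (x 0 i - y 0 i) < dpsi (x 0 i) * (x 0 i - y 0 i)
      - N))
    /\ 0 < s' < 1.
  apply: (@filter_ex _ (0 : R)^'+); near=> s; split; first split.
  - by near: s.
  - by near: s.
  - by apply/andP; split; near: s; [exact: nbhs_right_gt|exact: nbhs_right_lt].
have s'01 : 0 < s' <= 1 by rewrite s'0 ltW.
have Su' := S_ray hP Sx Xy Sx s'01; rewrite -/v in Su'.
have Iu' := dom_interior_coord K Ix Su'.1.
(* [s] is chosen after [s'], small enough for the net gain [s'] to absorb both the change of the
   model from [y] to [y + s *: v] and the part of the descent lost by starting at [s]. It stays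
   positive so that the secant bound applies at an interior point. *)
have [s [sm [s0 ss']]] : exists s, 
    s * (`|L| + 1) + `|model x y - model x (y + s *: v)| < s' /\ 0 < s /\ s <
      s'.
  apply: (@filter_ex _ (0 : R)^'+).
  have H : within X (nbhs y) [set z | `|model x y - model x z| < s' / 2].
    by apply: (model_near hP hG Xx Xy); rewrite divr_gt0.
  have H' := near_ray_within Xy Xx H.
  near=> s; split.
    have H1 : `|model x y - model x (y + s *: v)| < s' / 2 by near: s.
    have H2 : s * (`|L| + 1) < s' / 2.
      rewrite -ltr_pdivlMr ?ltr_pwDr//; near: s; apply: nbhs_right_lt.
      by rewrite divr_gt0// ?divr_gt0// ltr_pwDr.
    lra.
  by split; near: s; [exact: nbhs_right_gt|exact: nbhs_right_lt].
have s01 : 0 < s <= 1 by rewrite s0; lra.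
have Su := S_ray hP Sx Xy Sx s01; rewrite -/v in Su.
have Iu := dom_interior_coord K Ix Su.1.
exists s, s'; split => //.
rewrite -/v -subr_lt0 /objective opprD addrACA -mulrBr -sumrB.
have Hs : \sum_(j < n) (scalar_bregman phi ((y + s' *: v) 0 j) (x 0 j) -
    scalar_bregman phi ((y + s *: v) 0 j) (x 0 j)) <= (s' - s) * - N.
  rewrite (bigD1 i)//= -[leRHS]addr0; apply: lerD.
    apply: le_trans (kernel_secant _ i Sx (Iu i) (Iu' i)) _.
    have := Hi' (Iu' i); rewrite !mxE => HN.
    have sE : y 0 i + s' * (x 0 i - y 0 i) - (y 0 i + s * (x 0 i - y 0 i)) =
       (s' - s) * (x 0 i - y 0 i) by ring.
    rewrite sE mulrCA ler_pM2l ?subr_gt0//; lra.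
  (* In any other coordinate, the step from [s] to [s'] moves towards [x] without passing it, so
     monotonicity of the derivative rules out an increase. *)
  apply: sumr_le0 => j _.
  apply: le_trans (kernel_secant _ j Sx (Iu j) (Iu' j)) _.
  have := kernel_deriv_mono K (kernel_point K Ix j) (Iu' j)
    (dom_interior_coord K Ix Ix j).
  rewrite !mxE.
  set q := y 0 j + s' * _.
  have -> : x 0 j - q = (1 - s') * (x 0 j - y 0 j) by rewrite /q; ring.
  have -> : q - (y 0 j + s * (x 0 j - y 0 j)) = (s' - s) * (x 0 j - y 0 j)
    by rewrite /q; ring.
  rewrite ![_ * ((1 - s') * _)]mulrCA ler_pM2l ?subr_gt0// => mono.
  by rewrite mulrCA pmulr_rle0 ?subr_gt0//; lra.
have Ht : t^-1 * \sum_(j < n) (scalar_bregman phi ((y + s' *: v) 0 j) (x 0 j) -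
    scalar_bregman phi ((y + s *: v) 0 j) (x 0 j)) <= - ((s' - s) * (`|L| + 1)).
  have -> : - ((s' - s) * (`|L| + 1)) = t^-1 * ((s' - s) * - N).
    by rewrite /N; field; rewrite gt_eqF.
  by rewrite ler_pM2l ?invr_gt0.
have LL : s' * L <= s' * `|L| by rewrite ler_pM2l// ler_norm.
have LM := ler_norm (model x y - model x (y + s *: v)).
move: Hg' Ht sm LL LM.
set a := model x _; set b := model x _; set c := model x _; lra.
Unshelve. all: end_near. Qed.

(** The descent from [s] to [s'] persists, by continuity, on the segment from a nearby [y'] to [x].
    By convexity a value at [y'] no larger than the one at [s'] would keep the intermediate value at
    [s] too low. *)
Lemma objective_boundary_suboptimal (x y : 'rV[R]_n) : S x -> X y ->
  ~ (dom h)° y ->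
  exists2 z, S z & \forall y' \near y, S y' -> objective x z < objective x y'.
Proof.
move=> Sx Xy nIy; have [Ix Xx] := Sx.
have [s [s' [s0 ss' s'1 lt]]] := objective_descent_at_boundary Sx Xy nIy.
have s01 : 0 < s <= 1 by rewrite s0; lra.
have s'01 : 0 < s' <= 1 by apply/andP; split; lra.
exists (y + s' *: (x - y)); first exact: (S_ray hP Sx).
pose a := objective x (y + s' *: (x - y)).
pose b := objective x (y + s *: (x - y)).
have e0 : 0 < (b - a) / 3 by rewrite divr_gt0// subr_gt0.
have Ha := objective_near t hP hG Sx Xx (S_ray hP Sx Xy Sx s'01) e0.
have Hb := objective_near t hP hG Sx Xx (S_ray hP Sx Xy Sx s01) e0.
near=> y' => -[Iy' Xy'].
have Sy's := S_ray hP Sx Xy' Sx s'01.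
have Ha' : `|a - objective x (y' + s' *: (x - y'))| < (b - a) / 3.
  by move: Xy'; near: y'; exact: near_ray_base Ha.
have Hb' : `|b - objective x (y' + s *: (x - y'))| < (b - a) / 3.
  by move: Xy'; near: y'; exact: near_ray_base Hb.
(* The weight that writes the point at [s] as a combination of the point at [s'] and [y']. *)
have th01 : 0 < s / s' < 1.
  have s'0 : 0 < s' by lra.
  by rewrite divr_gt0//= ltr_pdivrMr// mul1r.
have Iys := Sy's.1.
have := objective_conv hP hG ht Sx Xx Sy's.2 (interior_subset Sy's.1) Xy'
  (interior_subset Iy') th01.
have -> : (s / s') *: (y' + s' *: (x - y')) + (1 - s / s')
  *: y' = y' + s *: (x - y').
  have s'0 : s' != 0 by rewrite gt_eqF//; lra.
  rewrite scalerDr scalerA divfK// scalerBl scale1r.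
  by rewrite [X in X + _]addrC -addrA [_ *: y' + (y' - _)]addrC subrK addrC.
move: Hb' Ha'; rewrite -/a !ltr_norml.
set p := objective x _; set q := objective x _; set r := objective x _.
set th := s / s'.
move: lt th01; rewrite -/a -/b =>
  lt /andP[th0 th1] /andP[H2 H3] /andP[H4 H5] H1.
rewrite ltNge; apply/negP => ra.
have : th * q <= th * (a + (b - a) / 3) by rewrite ler_pM2l//; lra.
have : (1 - th) * r <= (1 - th) * a by rewrite ler_pM2l// subr_gt0.
have : th * ((b - a) / 3) < (b - a) / 3 by rewrite gtr_pMl.
lra.
Unshelve. all: end_near. Qed.

(** In the non-compact case, (G4) with the constant base sequence [x] gives a radius beyond which
    every point of [S] is worse than [x]. *)
Lemma objective_coercive (x : 'rV[R]_n) : S x ->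
  exists C, [/\ compact C, C `<=` X &
    forall y, S y -> ~ C y -> objective x x < objective x y].
Proof.
move=> Sx; have [Ix Xx] := Sx.
case: (gamma_coercive hG) => [cX|coer].
  by exists X; split => // y [_ Xy] /(_ Xy).
have [M HM] : exists M : R, forall y, S y -> M < `|y| -> objective x x <
  objective x y.
  apply: contrapT => noM.
  have bad (k : nat) : exists y, [/\ S y, k%:R < `|y| & objective x y <=
    objective x x].
    apply: contrapT => nok; apply: noM; exists k%:R => y Sy ky.
    by rewrite ltNge; apply/negP => le; apply: nok; exists y.
  have [y Hy] := choice bad.
  have Sy k : S (y k) by have [] := Hy k.
  have ny : norm2 (y k) @[k --> \oo] --> +oo.
    apply/cvgryPge => A; near=> k; have [_ ky _] := Hy k.
    apply: le_trans (normr_le_norm2 _); apply: le_trans (ltW ky).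
    by near: k; exact: nbhs_infty_ger.
  have tt : 0 < t <= tbar by case/andP: ht => -> /ltW.
  have cy : subproblem gamma g h t (y k) x @[k --> \oo] --> +oo%E.
    exact: (coer t (fun=> x) y x tt (fun=> Sx) Sy ny (cvg_cst _) Xx).
  have [k] := filter_ex (iffLR (cvgeyPgt _) cy (objective x x)).
  have [[Iyk Xyk] _ le] := Hy k.
  rewrite (subproblem_fin gamma t hP Sx Sx Xyk (interior_subset Iyk)) lte_fin.
  by rewrite ltNge le.
exists [set y | X y /\ `|y| <= M]; split => [||y Sy nC].
- apply: bounded_closed_compact.
    exists M; split; first exact: num_real.
    by move=> M' MM' y [_ yM] /=; apply: le_trans yM (ltW MM').
  apply: closedI; first exact: X_closed hP.
  by apply: (@closed_comp _ _ (fun y : 'rV[R]_n => `|y|) [set r | r <= M]) =>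
    [y _|];
    [exact: norm_continuous|exact: closed_le].
- by move=> y [].
- by apply: HM => //; rewrite ltNge; apply/negP => yM; apply: nC; split;
  case: Sy.
Unshelve. all: end_near. Qed.

(** In [compact_local_min], a boundary point is handled by [objective_boundary_suboptimal]; at an
    interior point, continuity preserves the strict improvement that a missing minimum provides. *)
Lemma objective_minimizer (x : 'rV[R]_n) : S x ->
  exists2 y, S y & forall z, S z -> objective x y <= objective x z.
Proof.
move=> Sx; have [C [cC CX out]] := objective_coercive Sx.
apply: (compact_local_min cC Sx out) => y Cy dec.
have [Iy|nIy] := pselect ((dom h)° y); last first.
  exact: objective_boundary_suboptimal Sx (CX y Cy) nIy.
have Sy : S y by split => //; exact: CX.
have [z Sz zy] := dec y Sy; exists z => //.
have e0 : 0 < objective x y - objective x z by rewrite subr_gt0.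
have H := objective_near t hP hG Sx Sx.2 Sy e0.
refine (@filterS _ (nbhs y) _ _ _ _ H) => y' {}H [_ Xy'].
have := H Xy'.
by rewrite ltr_norml => /andP[]; lra.
Qed.

Lemma argmin_subproblem (x : 'rV[R]_n) : S x ->
  exists y, [/\ S y, objective x y <= objective x x &
    argmin (fun y => subproblem gamma g h t y x) = [set y]].
Proof.
move=> Sx; have [y Sy ymin] := objective_minimizer Sx.
have [Ix Xx] := Sx; have [Iy Xy] := Sy.
have Dx := interior_subset Ix; have Dy := interior_subset Iy.
have ymin' z : X z -> dom h z -> objective x y <= objective x z.
  move=> Xz Dz; rewrite leNgt; apply/negP => zy.
  have [zx|xz] := leP (objective x x) (objective x z).
    by have := ymin x Sx; rewrite leNgt (le_lt_trans zx zy).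
  (* Half the weight at which the chord from [z] to [x] reaches the value at [y]: the point at [s]
     lies in [S] and still has a value below the minimum. *)
  pose s := (objective x y - objective x z) / (objective x x - objective x z)
    / 2.
  have yx := ymin x Sx.
  have d0 : 0 < objective x x - objective x z by lra.
  have s0 : 0 < s by rewrite !divr_gt0//; lra.
  have s1 : s < 1.
    rewrite ltr_pdivrMr// mul1r.
    by apply: (@le_lt_trans _ _ 1); rewrite ?ler_pdivrMr ?mul1r ?lerB// ltr1n.
  have s01 : 0 < s <= 1 by rewrite s0 ltW.
  have := ymin _ (S_ray hP Sx Xz Sx s01).
  rewrite rayE; apply/negP; rewrite -ltNge.
  apply: le_lt_trans (objective_conv hP hG ht Sx Xx Xx Dx Xz Dz _) _;
    first by rewrite s0.
  have : s * (objective x x - objective x z) = (objective x y - objective x z)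
    / 2.
    by rewrite /s; field; rewrite gt_eqF.
  lra.
exists y; split => //; first exact: ymin.
apply/seteqP; split => [z zmin|_ -> z] /=; last first.
  have [[Xz Dz]|nz] := pselect (X z /\ dom h z); last first.
    by rewrite [leRHS](subproblem_pinfty gamma hP ht Sx Sx nz) leey.
  rewrite (subproblem_fin gamma t hP Sx Sx Xy Dy)
    (subproblem_fin gamma t hP Sx Sx Xz Dz).
  by rewrite lee_fin ymin'.
have := zmin y; have [[Xz Dz]|nz] := pselect (X z /\ dom h z); last first.
  by rewrite (subproblem_pinfty gamma hP ht Sx Sx nz)
    (subproblem_fin gamma t hP Sx Sx Xy Dy).
rewrite (subproblem_fin gamma t hP Sx Sx Xy Dy)
  (subproblem_fin gamma t hP Sx Sx Xz Dz) lee_fin => zy.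
apply: contrapT => /eqP nzy.
have h01 : 0 < (2^-1 : R) < 1 by lra.
have := objective_strict hP hG ht Sx Xx Xz Dz Xy Dy nzy h01.
have := ymin' _ (X_conv hP Xz Xy h01) (dom_h_conv hP Sx Dz Dy h01).
lra.
Qed.

End Existence.

(** * Gradients and projection onto the tangent space *)

Section Gradient.
Context {R : realType} {n : nat}.
Implicit Types (u v x : 'rV[R]_n).

Lemma diff_gradient (f : 'rV[R]_n -> R) x v : differentiable f x ->
  'd f x v = dotp (gradient f x) v.
Proof.
move=> df; rewrite [in LHS](row_sum_delta v) linear_sum /dotp.
apply: eq_bigr => i _; rewrite linearZ /= mxE deriveE//.
by rewrite /GRing.scale /= mulrC.
Qed.

(* Only the coordinates outside [Bset phi x] can be matched within the tangent
   space, so the nearest point agrees with [v] there. *)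
Lemma dotp_proj_tangent (phi : R -> \bar R) x v u : tangent phi x u ->
  dotp (Defs.proj (tangent phi x) v) u = dotp v u.
Proof.
move=> Tu.
pose v0 : 'rV[R]_n := \row_i (if `[< Bset phi x i >] then 0 else v 0 i).
have Tv0 : tangent phi x v0 by move=> b Bb; rewrite mxE; case: asboolP.
have term y i : tangent phi x y ->
    0 <= (v - y) 0 i * (v - y) 0 i - (v - v0) 0 i * (v - v0) 0 i.
  move=> Ty; rewrite !mxE; case: asboolP => [Bi|_].
    by rewrite (Ty i Bi) subrr.
  by rewrite subrr mul0r subr0 -expr2 sqr_ge0.
have sq y : 0 <= dotp y y.
  by apply: sumr_ge0 => i _; rewrite -expr2 sqr_ge0.
rewrite /Defs.proj; case: xgetP => [y _ [Ty ymin]|noproj].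
  have := ymin v0 Tv0; rewrite /norm2 ler_sqrt ?sq// -subr_le0 /dotp -sumrB =>
    le0.
  have {le0} : \sum_(i < n) ((v - y) 0 i * (v - y) 0 i -
      (v - v0) 0 i * (v - v0) 0 i) = 0.
    by apply/eqP; rewrite eq_le le0 sumr_ge0// => i _; exact: term.
  move=> /(psumr_eq0P (fun i _ => term y i Ty)) eq0.
  apply: eq_bigr => i _; have [Bi|nBi] := pselect (Bset phi x i).
    by rewrite (Tu i Bi) !mulr0.
  have := eq0 i isT; rewrite !mxE; case: asboolP => // _.
  rewrite subrr mul0r subr0 => /eqP; rewrite mulf_eq0 orbb subr_eq0.
  by move=> /eqP ->.
(* [v0] is itself a nearest point, so [xget] never falls back to its default [0]. *)
exfalso; apply: (noproj v0); split => // y Ty.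
rewrite ler_wsqrtr// -subr_ge0 /dotp -sumrB.
by apply: sumr_ge0 => i _; exact: term.
Qed.

Lemma dotpN u v : dotp (- u) v = - dotp u v.
Proof. by rewrite /dotp -sumrN; apply: eq_bigr => i _; rewrite mxE mulNr. Qed.

Lemma dotpZr u v (l : R) : dotp u (l *: v) = l * dotp u v.
Proof.
by rewrite /dotp mulr_sumr; apply: eq_bigr => i _; rewrite mxE mulrCA.
Qed.

End Gradient.

(** * The scalar Bregman divergence at boundary and interior points *)

Section ScalarBregman.
Context {R : realType} {n : nat} {phi : R -> \bar R} {h : 'rV[R]_n -> \bar R}.
Hypothesis K : separable_kernel phi h.
Variable o : R.
Hypothesis Io : (dom phi)° o.
Local Notation psi := (fine \o phi).
Local Notation dpsi := (derive1 (fine \o phi)).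

(* The interior of the domain lies on one side of a boundary point, so [d]
   lies on the same side of [c] as [o]. *)
Lemma kernel_point_between (c d : R) : bd (dom phi) c ->
  closure (dom phi) d -> d != c ->
  exists2 m, (dom phi)° m & exists2 q, 0 < q & d - m = q * (m - c).
Proof.
move=> [Cc nIc] Cd dc.
have oc : o != c by apply/eqP => oc; apply: nIc; rewrite -oc.
have dc0 : d - c != 0 by rewrite subr_eq0.
have oc0 : o - c != 0 by rewrite subr_eq0.
pose r := (d - c) / (o - c).
have r0 : 0 < r.
  have r_neq0 : r != 0 by rewrite mulf_neq0// invr_eq0.
  rewrite lt_neqAle eq_sym r_neq0 leNgt; apply/negP => r_lt0; apply: nIc.
  (* For negative [r], the point [c] lies strictly between [d] and [o], hence in the interior. *)
  have -> : c = d + (- r / (1 - r)) * (o - d).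
    have r1 : o - c - (d - c) != 0.
      rewrite opprB addrA subrK subr_eq0; apply/eqP => od.
      by move: r_lt0; rewrite /r od divff//; lra.
    by rewrite /r; field; rewrite oc0 //=.
  apply: (kernel_interior_ray K Cd Io).
  have r1 : 0 < 1 - r by lra.
  by rewrite divr_gt0 ?oppr_gt0//= ler_pdivrMr//; lra.
have r1 : 0 < 1 + r by lra.
(* The weight is below both [1] and [r], which puts [m] between [c] and each of [o] and [d]; it is
   the weight for which the ratio [q] equals [r]. *)
exists (c + r / (1 + r) * (o - c)).
  apply: (kernel_interior_ray K Cc Io).
  by rewrite divr_gt0//= ler_pdivrMr//; lra.
exists r => //.
have -> : d = c + r * (o - c) by rewrite /r divfK// addrC subrK.
by field; rewrite gt_eqF.
Qed.

(** Through a point [m] between [c] and [d], the divergence is at least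
    [(dpsi m - dpsi x) * (v - m)]. Here [v - m] stays a positive multiple of [m - c], and
    [dpsi x * (m - c)] tends to [-oo] as [x] tends to [c]. *)
Lemma scalar_bregman_blowup (c d C : R) : bd (dom phi) c ->
  closure (dom phi) d -> d != c ->
  \forall v \near d & x \near c,
    (dom phi)° v -> (dom phi)° x -> C < scalar_bregman phi v x.
Proof.
move=> Bc Cd dc.
have [m Im [q q0 dm]] := kernel_point_between Bc Cd dc.
have mc : m - c != 0.
  by rewrite subr_eq0; apply/eqP => mc; move: Bc; rewrite -mc => -[].
(* Since [v - m] is at least [q / 2] times [m - c], this threshold makes the lower bound exceed
   [|C| + 1]. *)
pose M := dpsi m * (m - c) - (`|C| + 1) * 2 / q.
exists ([set v | `|d - v| < q / 2 * `|m - c|],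
        [set x | (dom phi)° x -> dpsi x * (m - c) < M]).
  split => /=; last exact: (kernel_steep_dir K Io M Bc Im).
  have e0 : 0 < q / 2 * `|m - c| by rewrite mulr_gt0 ?divr_gt0 ?normr_gt0.
  exact: (nbhs_ball_norm d (PosNum e0)).
move=> [v x] /= [vd Hx] Iv Ix.
have Hm : (dpsi m - dpsi x) * (v - m) <= scalar_bregman phi v x.
  have := kernel_grad_ge K Io Im Iv; have := kernel_grad_ge K Io Ix Im.
  rewrite /scalar_bregman /=; lra.
apply: lt_le_trans Hm.
pose k := (v - m) / (m - c).
have kE : v - m = k * (m - c) by rewrite /k divfK.
have k2 : q / 2 < k.
  have : `|q - k| < q / 2.
    rewrite -(ltr_pM2r (_ : 0 < `|m - c|)) ?normr_gt0// -normrM mulrBl -dm -kE.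
    by rewrite opprB addrA subrK.
  by rewrite ltr_norml; lra.
rewrite kE mulrCA mulrBl.
have HM : (`|C| + 1) * 2 / q < dpsi m * (m - c) - dpsi x * (m - c).
  by have := Hx Ix; rewrite /M; lra.
have N0 : 0 < (`|C| + 1) * 2 / q.
  by rewrite divr_gt0// mulr_gt0// ltr_wpDl.
have : q / 2 * ((`|C| + 1) * 2 / q) < k * (dpsi m * (m - c) - dpsi x * (m - c)).
  by apply: ltr_pM => //; rewrite ltW// divr_gt0.
have -> : q / 2 * ((`|C| + 1) * 2 / q) = `|C| + 1 by field; rewrite gt_eqF.
by have := ler_norm C; lra.
Qed.

Lemma scalar_bregman_cvg (b a : R) : (dom phi)° b -> (dom phi)° a ->
  scalar_bregman phi p.1 p.2 @[p --> (b, a)] --> scalar_bregman phi b a.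
Proof.
move=> Ib Ia.
have psi_cvg r : (dom phi)° r -> psi s @[s --> r] --> psi r.
  move=> Ir; have [_ dr _] := kernel_C1 K Ir.
  exact/differentiable_continuous/derivable1_diffP.
have [_ _ ca] := kernel_C1 K Ia.
have c1 : p.1 @[p --> (b, a)] --> b by exact: cvg_fst.
have c2 : p.2 @[p --> (b, a)] --> a by exact: cvg_snd.
apply: cvgB.
  apply: cvgB.
    exact: (cvg_comp _ psi c1 (psi_cvg _ Ib)).
  exact: (cvg_comp _ psi c2 (psi_cvg _ Ia)).
apply: cvgM; first exact: (cvg_comp _ dpsi c2 ca).
by apply: cvgB.
Qed.

End ScalarBregman.

(** * One step taken from near the stationary point *)

Section NearStationary.
Context {R : realType} {n : nat}.
Variables (f : 'rV[R]_n -> R) (g h : 'rV[R]_n -> \bar R) (phi : R -> \bar R).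
Variables (gamma : 'rV[R]_n -> 'rV[R]_n -> R) (X : set 'rV[R]_n) (tbar t : R).
Hypothesis hP : problem_assumptions f g phi h X.
Hypothesis hG : surrogate_assumptions f g h X gamma tbar.
Hypothesis ht : 0 < t < tbar.

Let K := h_kernel hP.
Local Notation psi := (fine \o phi).
Local Notation dpsi := (derive1 (fine \o phi)).
Local Notation S := ((dom h)° `&` X).
Local Notation model := (model g gamma).
Local Notation objective := (objective g phi gamma t).

Let t_gt0 : 0 < t. Proof. by case/andP: ht. Qed.
Let tbar_gt0 : 0 < tbar. Proof. by case/andP: ht; lra. Qed.

Variables xs w : 'rV[R]_n.
Hypothesis Sw : S w.
Hypothesis Xxs : X xs.

Local Notation active := (fun i => `[< Bset phi xs i >]).

Definition free_interior (y : 'rV[R]_n) : Prop :=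
  forall i, ~ Bset phi xs i -> (dom phi)° (y 0 i).

(** [phi] may be infinite at the boundary values of the active coordinates, so on the manifold only
    the free coordinates are summed. *)
Definition free_kernel (y : 'rV[R]_n) : R :=
  \sum_(i < n | ~~ active i) psi (y 0 i).

Definition free_bregman (y x : 'rV[R]_n) : R :=
  \sum_(i < n | ~~ active i) scalar_bregman phi (y 0 i) (x 0 i).

Lemma free_interior_base : free_interior xs.
Proof.
move=> i nB; apply: contrapT => nI; apply: nB; split => //.
apply: (@closure_dom_coord _ _ _ _ K _ Sw.1 xs _ i).
by case: (X_domh hP) => _; exact.
Qed.

Lemma near_free_interior : \forall y \near xs, free_interior y.
Proof.
have H i : nbhs xs [set y : 'rV[R]_n | ~ Bset phi xs i -> (dom phi)° (y 0 i)].
  have [Bi|nBi] := pselect (Bset phi xs i).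
    by refine (@filterS _ (nbhs xs) _ _ _ _ filterT) => y _ /(_ Bi).
  have Ii := free_interior_base nBi.
  have H' : nbhs (xs 0 i) (dom phi)° by exact: (nbhs_interior Ii).
  by refine (@filterS _ (nbhs xs) _ _ _ _ (near_coord H')) => y Iy _.
exact: (@filter_forall _ _ _ (nbhs xs) _ H).
Qed.

Lemma surrogate_conv (p q : 'rV[R]_n) (l : R) : S p -> S q -> 0 < l < 1 ->
  tbar * model xs (l *: p + (1 - l) *: q) +
    \sum_(i < n) psi ((l *: p + (1 - l) *: q) 0 i) <=
  l * (tbar * model xs p + \sum_(i < n) psi (p 0 i)) +
    (1 - l) * (tbar * model xs q + \sum_(i < n) psi (q 0 i)).
Proof.
move=> [Ip Xp] [Iq Xq] l01; have [<-|pq] := eqVneq p q.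
  by rewrite -scalerDl -mulrDl [l + _]addrC subrK scale1r mul1r.
apply/ltW/(surrogate_strict hP hG Sw) => //; exact: interior_subset.
Qed.

Lemma free_model_near (y : 'rV[R]_n) (e : R) : X y -> free_interior y -> 0 <
  e ->
  \forall z \near y, X z ->
    `|tbar * model xs y + free_kernel y - (tbar * model xs z + free_kernel z)| <
      e.
Proof.
move=> Xy Fy e0.
have : tbar * model xs z + free_kernel z @[z --> within X (nbhs y)] -->
    tbar * model xs y + free_kernel y.
  apply: cvgD.
    by apply: cvgM; [exact:
      cvg_cst|exact: (@model_continuous _ _ _ _ _ _ _ _ _ hP hG)].
  apply: cvg_within_filter; apply: cvg_big => [|i]; first exact: add_continuous.
  move=> /asboolPn /Fy Ii.
  apply: (cvg_comp (fun z : 'rV[R]_n => z 0 i) psi).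
    exact: coord_continuous.
  have [_ di _] := kernel_C1 K Ii.
  exact/differentiable_continuous/derivable1_diffP.
by move=> /cvgrPdist_lt/(_ e e0).
Qed.

(* Moving [p] and [q] towards the interior point [w] gives them equal active
   coordinates, whose contributions cancel in (G3). *)
Lemma free_surrogate_conv (p q : 'rV[R]_n) (l : R) :
  X p -> manifold phi xs p -> free_interior p ->
  X q -> manifold phi xs q -> free_interior q -> 0 < l < 1 ->
  tbar * model xs (l *: p + (1 - l) *: q) + free_kernel (l *: p + (1 - l) *: q)
  <= l * (tbar * model xs p + free_kernel p) +
    (1 - l) * (tbar * model xs q + free_kernel q).
Proof.
move=> Xp Mp Fp Xq Mq Fq l01; set u := l *: p + (1 - l) *: q.
have Xu : X u by exact: (X_conv hP).
have Fu : free_interior u.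
  move=> i nBi; rewrite !mxE.
  have -> : l * p 0 i + (1 - l) * q 0 i = q 0 i + l * (p 0 i - q 0 i) by ring.
  apply: (kernel_interior_ray K) => //; last by case/andP: l01 => -> /ltW.
    exact: (subset_closure (interior_subset (Fq i nBi))).
  exact: Fp.
pose Phi z := tbar * model xs z + free_kernel z.
rewrite -/(Phi u) -/(Phi p) -/(Phi q) leNgt; apply/negP => lt.
(* A third of the supposed violation: the perturbations of [p] and [q] together cost at most [e],
   and that of [u] another [e]. *)
pose e := (Phi u - (l * Phi p + (1 - l) * Phi q)) / 3.
have e0 : 0 < e by rewrite divr_gt0// subr_gt0.
have Np := near_ray_within hP Xp Sw.2 (free_model_near Xp Fp e0).
have Nq := near_ray_within hP Xq Sw.2 (free_model_near Xq Fq e0).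
have Nu := near_ray_within hP Xu Sw.2 (free_model_near Xu Fu e0).
have N01 : \forall s \near (0 : R)^'+, 0 < s <= 1.
  near=> s; apply/andP; split; near: s; first exact: nbhs_right_gt.
  exact: nbhs_right_le.
have [s [[/= Hp Hq] [Hu s01]]] := filter_ex (filterI (filterI Np Nq)
  (filterI Nu N01)).
have Sp := S_ray hP Sw Xp Sw s01; have Sq := S_ray hP Sw Xq Sw s01.
have := surrogate_conv Sp Sq l01.
have -> : l *: (p + s *: (w - p)) + (1 - l) *: (q + s *: (w - q))
  = u + s *: (w - u).
  by apply/rowP => i; rewrite !mxE; ring.
have sumID (y : 'rV[R]_n) : \sum_(i < n) psi (y 0 i) =
    \sum_(i < n | active i) psi (y 0 i) + free_kernel y.
  by rewrite (bigID active).
rewrite !sumID; set Ap := \sum_(i < n | _) psi ((p + _) 0 i).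
have AE (y : 'rV[R]_n) : manifold phi xs y ->
    \sum_(i < n | active i) psi ((y + s *: (w - y)) 0 i) = Ap.
  move=> My; apply: eq_bigr => i /asboolP Bi; rewrite !mxE.
  by rewrite (My i Bi) (Mp i Bi).
have Mu : manifold phi xs u.
  by move=> i Bi; rewrite !mxE (Mp i Bi) (Mq i Bi); ring.
rewrite (AE q Mq) (AE u Mu).
move: Hp Hq Hu; rewrite -!/(Phi _) !ltr_norml /Phi.
set ap := model xs p; set aq := model xs q; set au := model xs u.
set bp := free_kernel p; set bq := free_kernel q; set bu := free_kernel u.
set ap' := model xs _; set bp' := free_kernel _.
set aq' := model xs _; set bq' := free_kernel _.
set au' := model xs _; set bu' := free_kernel _.
move=> /andP[Hp _] /andP[Hq _] /andP[_ Hu] Hc.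
have l0 : 0 < l by case/andP: l01.
have l1 : 0 < 1 - l by rewrite subr_gt0; case/andP: l01.
have /ltW Hp2 : l * (tbar * ap' + bp') < l * (tbar * ap + bp + e).
  by rewrite ltr_pM2l//; lra.
have /ltW Hq2 : (1 - l) * (tbar * aq' + bq') < (1 - l) * (tbar * aq + bq + e).
  by rewrite ltr_pM2l//; lra.
have : e * 3 = Phi u - (l * Phi p + (1 - l) * Phi q) by rewrite /e divfK.
rewrite /Phi -/ap -/aq -/au -/bp -/bq -/bu; lra.
Unshelve. all: end_near. Qed.

(** Stationarity on the manifold in variational form; [spurious_stationary_ge] derives it from
    [spurious_stationary]. *)
Hypothesis stat : forall y, X y -> manifold phi xs y ->
  - dotp (gradient f xs) (y - xs) <= fine (g y) - fine (g xs).

(** The convex function of [free_surrogate_conv] lies above its tangent at [xs]. By (G2) and [stat]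
    the model has nonnegative slope there, and what remains of the kernel is the free Bregman
    divergence. *)
Lemma model_manifold_ge (v : 'rV[R]_n) : X v -> manifold phi xs v ->
  free_interior v -> model xs xs - tbar^-1 * free_bregman v xs <= model xs v.
Proof.
move=> Xv Mv Fv; rewrite leNgt; apply/negP => lt.
have Fxs := free_interior_base.
have Mxs : manifold phi xs xs by [].
have [_ /(_ xs xs Xxs Xxs) dxs _] := gamma_C1 hG.
pose e := (model xs xs - tbar^-1 * free_bregman v xs - model xs v) / 2.
have e0 : 0 < e by rewrite divr_gt0// subr_gt0.
have N1 := differentiable_ray (v - xs) dxs e0.
have N01 : \forall l \near (0 : R)^'+, 0 < l < 1.
  by near=> l; apply/andP; split; near: l;
    [exact: nbhs_right_gt|exact: nbhs_right_lt].
have [l [/= Hl /[dup] l01 /andP[l0 l1]]] := filter_ex (filterI N1 N01).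
have := free_surrogate_conv Xv Mv Fv Xxs Mxs Fxs l01.
rewrite -rayE; set u := xs + l *: (v - xs) => Hc.
have Xu : X u by rewrite /u rayE; exact: (X_conv hP).
have Mu : manifold phi xs u.
  by move=> i Bi; rewrite !mxE (Mv i Bi) subrr mulr0 addr0.
have Hg := stat Xu Mu.
rewrite /u addrAC subrr add0r dotpZr -/u in Hg.
rewrite (diff_gradient _ dxs) (gamma_first_order hG Xxs).1 in Hl.
have Hk : l * \sum_(i < n | ~~ active i) dpsi (xs 0 i) * (v 0 i - xs 0 i) <=
    free_kernel u - free_kernel xs.
  rewrite mulr_sumr -sumrB; apply: ler_sum => i /asboolPn nBi.
  have Ii := Fxs i nBi.
  have Iui : (dom phi)° (u 0 i).
    rewrite !mxE; apply: (kernel_interior_ray K); last by rewrite l0 ltW.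
      exact: (subset_closure (interior_subset Ii)).
    exact: Fv.
  have := kernel_grad_ge K Ii Ii Iui.
  by rewrite !mxE [in X in X <= _]addrAC subrr add0r mulrCA.
have Hb : free_bregman v xs = free_kernel v - free_kernel xs -
    \sum_(i < n | ~~ active i) dpsi (xs 0 i) * (v 0 i - xs 0 i).
  by rewrite /free_bregman /free_kernel -!sumrB.
move: Hl; rewrite ler_norml => /andP[Hl _].
(* The bound from [stat] cancels the linear term of the expansion, leaving only its error. *)
have Hm : - (e * l) <= model xs u - model xs xs by rewrite /model; lra.
have : l * (tbar * e) < l * 0.
  have eE : tbar * e * 2 = tbar * (model xs xs - model xs v)
    - free_bregman v xs.
    by rewrite /e; field; rewrite gt_eqF.
  have tm := ler_wpM2l (ltW tbar_gt0) Hm.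
  have le2 : l * (tbar * e * 2) =
    l * (tbar * (model xs xs - model xs v) - free_bregman v xs) by rewrite eE.
  have lte0 : 0 < l * (tbar * e) by rewrite mulr_gt0// mulr_gt0.
  rewrite Hb in le2.
  lra.
by rewrite ltr_pM2l// ltNge ltW// mulr_gt0.
Unshelve. all: end_near. Qed.

Lemma objective_diag (x : 'rV[R]_n) : objective x x = model x x.
Proof.
rewrite /objective big1 ?mulr0 ?addr0// => i _.
by rewrite /scalar_bregman; ring.
Qed.

Lemma model_joint_near (v : 'rV[R]_n) (e : R) : X v -> 0 < e ->
  \forall v' \near v & x \near xs, X v' -> X x ->
    `|model xs v - model x v'| < e.
Proof.
move=> Xv e0; have e2 : 0 < e / 2 by rewrite divr_gt0.
have [cg _ _] := gamma_C1 hG.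
move/subspace_continuousP : cg => /(_ (v, xs) (conj Xv Xxs)).
move=> /cvgrPdist_lt/(_ _ e2); rewrite near_withinE => -[[U V] /= [Uv Vx] HUV].
have /cvgrPdist_lt/(_ _ e2) := @g_continuous _ _ _ _ _ _ _ hP v Xv.
rewrite near_withinE => Hg.
exists (U `&` [set y | X y -> `|fine (g v) - fine (g y)| < e / 2], V).
  by split => //=; exact: filterI.
move=> [v' x] /= [[Uv' Hv'] Vx'] Xv' Xx'.
have : `|gamma v xs - gamma v' x| < e / 2.
  exact: (HUV (v', x) (conj Uv' Vx') (conj Xv' Xx')).
have := Hv' Xv'; rewrite /model !ltr_norml => /andP[a1 a2] /andP[a3 a4].
by apply/andP; split; lra.
Qed.

Lemma free_bregman_near (v : 'rV[R]_n) (e : R) : free_interior v -> 0 < e ->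
  \forall v' \near v & x \near xs,
    `|free_bregman v xs - free_bregman v' x| < e.
Proof.
move=> Fv e0.
have : free_bregman p.1 p.2 @[p --> (v, xs)] --> free_bregman v xs.
  apply: cvg_big => [|i]; first exact: add_continuous.
  move=> /asboolPn nBi.
  have c1 : (p.1 : 'rV[R]_n) 0 i @[p --> (v, xs)] --> v 0 i.
    apply: (cvg_comp _ (fun y : 'rV[R]_n => y 0 i) cvg_fst).
    exact: coord_continuous.
  have c2 : (p.2 : 'rV[R]_n) 0 i @[p --> (v, xs)] --> xs 0 i.
    apply: (cvg_comp _ (fun y : 'rV[R]_n => y 0 i) cvg_snd).
    exact: coord_continuous.
  have := @scalar_bregman_cvg _ _ _ _ K _ _ (Fv i nBi) (free_interior_base nBi).
  exact: (cvg_comp _ _ (cvg_pair c1 c2)).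
move=> /cvgrPdist_lt/(_ e e0) [[U V] /= [Uv Vx] HUV].
by exists (U, V) => // p Hp; exact: HUV p Hp.
Qed.

(** [xs] may lie outside the interior, so [v'] is compared with the base point [x], where the
    Bregman term vanishes. *)
Lemma objective_gt_near (v : 'rV[R]_n) : X v -> v != xs -> free_interior v ->
  \forall v' \near v & x \near xs, S v' -> S x ->
    objective x x < objective x v'.
Proof.
move=> Xv vxs Fv.
have [[i Bi vi]|Mv] := pselect (exists2 i, Bset phi xs i & v 0 i != xs 0 i).
  (* The summand [2] covers the two approximation errors of size [1] in the model values. *)
  pose C := t * (`|model xs v - model xs xs| + 2).
  have Cv : closure (dom phi) (v 0 i).
    apply: (@closure_dom_coord _ _ _ _ K _ Sw.1 v _ i).
    by case: (X_domh hP) => _; exact.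
  have [[U V] /= [Uv Vx] HUV] :=
    @scalar_bregman_blowup _ _ _ _ K _ (kernel_point K Sw.1 i) _ _ C Bi Cv vi.
  have [[U1 V1] /= [Uv1 Vx1] HUV1] := model_joint_near Xv ltr01.
  have [[U2 V2] /= [Uv2 Vx2] HUV2] := model_joint_near Xxs ltr01.
  exists ((fun y : 'rV[R]_n => U (y 0 i)) `&` U1,
          (fun y : 'rV[R]_n => V (y 0 i)) `&` V1 `&` (U2 `&` V2)).
    split => /=; first by apply: filterI => //; exact: near_coord.
    by apply: filterI; apply: filterI => //; exact: near_coord.
  move=> [v' x] /= [[Uv' U1v'] [[Vx' V1x] [U2x V2x]]] [Iv' Xv'] [Ix Xx].
  have Iv'i := dom_interior_coord K Sw.1 Iv'.
  have Ixi := dom_interior_coord K Sw.1 Ix.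
  have HB := HUV (v' 0 i, x 0 i) (conj Uv' Vx') (Iv'i i) (Ixi i).
  have H1 := HUV1 (v', x) (conj U1v' V1x) Xv' Xx.
  have H2 := HUV2 (x, x) (conj U2x V2x) Xx Xx.
  rewrite /= in HB H1 H2.
  have Hsum : C < \sum_(j < n) scalar_bregman phi (v' 0 j) (x 0 j).
    apply: (lt_le_trans HB); rewrite (bigD1 i)//= lerDl; apply: sumr_ge0 => j _.
    exact: (scalar_bregman_ge0 K Sw.1 j).
  have Ht : t^-1 * C < t^-1 * \sum_(j < n) scalar_bregman phi (v' 0 j) (x 0 j).
    by rewrite ltr_pM2l ?invr_gt0.
  rewrite objective_diag /objective.
  rewrite /C mulKf ?gt_eqF// in Ht.
  have := ler_norm (- (model xs v - model xs xs)); rewrite normrN.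
  move: H1 H2; rewrite !ltr_norml => /andP[_ H1] /andP[H2 _].
  lra.
have {}Mv : manifold phi xs v.
  by move=> i Bi; apply/eqP; apply: contrapT => /negP vi; apply: Mv; exists i.
have Fxs := free_interior_base.
have Hcore := model_manifold_ge Xv Mv Fv.
have D0 : 0 < free_bregman v xs.
  have [i vi] : exists i, v 0 i != xs 0 i.
    apply: contrapT => nex; move/eqP: vxs; apply; apply/rowP => i.
    by apply/eqP; apply: contrapT => /negP vi; apply: nex; exists i.
  have nBi : ~ Bset phi xs i by move=> /Mv/eqP; rewrite (negPf vi).
  rewrite /free_bregman (bigD1 i)/=; last exact/asboolPn.
  apply: ltr_pwDl.
    exact: (scalar_bregman_gt0 K Sw.1 i (Fv i nBi) (Fxs i nBi) vi).
  apply: sumr_ge0 => j /andP[/asboolPn nBj _].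
  exact: (scalar_bregman_ge0 K Sw.1 j (Fv j nBj) (Fxs j nBj)).
(* A third of the margin, for three errors: two in the model values and one in the Bregman term,
   where [t * e] becomes [e] after division by [t]. *)
pose e := (t^-1 - tbar^-1) * free_bregman v xs / 3.
have c0 : 0 < t^-1 - tbar^-1.
  by rewrite subr_gt0 ltf_pV2 ?posrE//; case/andP: ht.
have e0 : 0 < e by rewrite divr_gt0// mulr_gt0.
have te0 : 0 < t * e by rewrite mulr_gt0.
have [[U V] /= [Uv Vx] HUV] := free_bregman_near Fv te0.
have [[U1 V1] /= [Uv1 Vx1] HUV1] := model_joint_near Xv e0.
have [[U2 V2] /= [Uv2 Vx2] HUV2] := model_joint_near Xxs e0.
exists (U `&` U1, V `&` V1 `&` (U2 `&` V2)).
  split => /=; first exact: filterI.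
  by apply: filterI; exact: filterI.
move=> [v' x] /= [[Uv' U1v'] [[Vx' V1x] [U2x V2x]]] [Iv' Xv'] [Ix Xx].
have HB := HUV (v', x) (conj Uv' Vx').
have H1 := HUV1 (v', x) (conj U1v' V1x) Xv' Xx.
have H2 := HUV2 (x, x) (conj U2x V2x) Xx Xx.
rewrite /= in HB H1 H2.
have Hsum : free_bregman v' x <= \sum_(j < n) scalar_bregman phi (v' 0 j)
  (x 0 j).
  rewrite [leRHS](bigID active) /= lerDr; apply: sumr_ge0 => j _.
  by apply: (scalar_bregman_ge0 K Sw.1 j); exact: (dom_interior_coord K Sw.1).
move: HB H1 H2; rewrite !ltr_norml => /andP[_ HB] /andP[_ H1] /andP[H2 _].
have Ht : t^-1 * (free_bregman v xs - t * e) <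
    t^-1 * \sum_(j < n) scalar_bregman phi (v' 0 j) (x 0 j).
  by rewrite ltr_pM2l ?invr_gt0//; lra.
rewrite mulrBr mulKf ?gt_eqF// in Ht.
have eE : e * 3 = t^-1 * free_bregman v xs - tbar^-1 * free_bregman v xs.
  by rewrite /e divfK// mulrBl.
rewrite objective_diag /objective; lra.
Qed.

(** Every point of [S] in a compact shell around [xs] is worse than a base point [x] close to [xs].
    Were [y] beyond the shell, the segment from [x] to [y] would meet it at a point that convexity
    makes no worse than [x]. *)
Lemma iterate_near (eps : R) : 0 < eps ->
  exists2 d, 0 < d & forall x y, S x -> S y -> `|x - xs| < d ->
    objective x y <= objective x x -> `|y - xs| < eps.
Proof.
move=> eps0.
have [r /= r0 Hr] := (nbhs_ballP _ _).1 near_free_interior.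
(* The bound [r / 2] keeps the shell where free coordinates remain interior. *)
pose e := Num.min eps (r / 2).
have e0 : 0 < e by rewrite lt_min eps0 divr_gt0.
have er : e < r by rewrite gt_min (_ : r / 2 < r) ?orbT//; lra.
pose C := [set v : 'rV[R]_n | [/\ X v, e / 2 <= `|v - xs| & `|v - xs| <= e]].
have cC : compact C.
  apply: bounded_closed_compact.
    exists (`|xs| + e); split; first exact: num_real.
    move=> M HM v [_ _ vle] /=; apply: le_trans (ltW HM).
    rewrite -(subrK xs v); apply: le_trans (ler_normD _ _) _.
    by rewrite addrC lerD2l.
  have dc : continuous (fun v : 'rV[R]_n => `|v - xs|).
    exact: continuous_norm_sub.
  have -> : C = X `&` ((fun v : 'rV[R]_n => `|v - xs|) @^-1` [set r | e / 2 <=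
    r] `&`
     (fun v : 'rV[R]_n => `|v - xs|) @^-1` [set r | r <= e]).
    by apply/seteqP; split=> v [? []].
  apply: closedI; first exact: (X_closed hP).
  apply: closedI.
    by apply: closed_comp => [v _|]; [exact: dc|exact: closed_ge].
  by apply: closed_comp => [v _|]; [exact: dc|exact: closed_le].
have near_ok : nbhs xs [set x | C `<=` (fun v => S v -> S x ->
    objective x x < objective x v)].
  (* Compactness of the shell makes the neighbourhood of base points uniform in [v]. *)
  have /compact_near_coveringP cov := cC.
  refine (cov _ (nbhs xs) (fun x v => S v -> S x ->
    objective x x < objective x v) _ _) => v [Xv v1 v2].
  apply: objective_gt_near => //.
    by apply: contraTN v1 => /eqP ->; rewrite subrr normr0 -ltNge divr_gt0.
  apply: Hr; rewrite -ball_normE /= distrC; exact: le_lt_trans er.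
have [d1 /= d10 Hd1] := (nbhs_ballP _ _).1 near_ok.
exists (Num.min d1 (e / 4)); first by rewrite lt_min d10 divr_gt0.
move=> x y Sx Sy; rewrite lt_min => /andP[xd1 xe] le.
suff : `|y - xs| < e by rewrite lt_min => /andP[].
rewrite ltNge; apply/negP => ey.
have Hx : forall v, C v -> S v -> objective x x < objective x v.
  move=> v Cv Sv; apply: (Hd1 x _ v Cv Sv Sx).
  by rewrite -ball_normE /= distrC.
have yx : e * 3 / 4 <= `|y - x|.
  have := ler_normD (y - x) (x - xs); rewrite addrA subrK; lra.
(* This places the point at distance [e * 3 / 4] from [x]; as [x] is within [e / 4] of [xs], it
   lands in the shell. *)
pose s := e * 3 / 4 / `|y - x|.
have yx0 : 0 < `|y - x| by lra.
have s01 : 0 < s <= 1 by rewrite divr_gt0//= ?ler_pdivrMr ?mul1r//; lra.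
have Sv := S_ray hP Sw Sx.2 Sy s01.
have Cv : C (x + s *: (y - x)).
  have nE : `|s *: (y - x)| = e * 3 / 4.
    by rewrite normrZ gtr0_norm ?(andP s01).1// /s divfK// gt_eqF.
  have vE : x + s *: (y - x) - xs = s *: (y - x) + (x - xs)
    by rewrite addrAC addrC.
  split; first exact: Sv.2.
    have := lerB_normD (s *: (y - x)) (x - xs); rewrite vE nE; lra.
  have := ler_normD (s *: (y - x)) (x - xs); rewrite vE nE; lra.
have := Hx _ Cv Sv; apply/negP; rewrite -leNgt.
have [Ix Xx] := Sx; have [Iy Xy] := Sy.
move: s01 => /andP[s0]; rewrite le_eqVlt => /predU1P[->|s1].
  by rewrite scale1r addrC subrK.
rewrite rayE; apply:
  le_trans (objective_conv hP hG ht Sw Xx Xy (interior_subset Iy) Xx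
  (interior_subset Ix) _) _; first by rewrite s0.
have : s * objective x y <= s * objective x x by rewrite ler_pM2l.
lra.
Qed.

End NearStationary.

(** [y - xs] is tangent to the manifold, so the projected gradient and the full one have the same
    product with it. *)
Lemma spurious_stationary_ge {R : realType} {n : nat} (f : 'rV[R]_n -> R)
    (g h : 'rV[R]_n -> \bar R) (phi : R -> \bar R) (X : set 'rV[R]_n)
    (xs : 'rV[R]_n) :
  problem_assumptions f g phi h X -> spurious_stationary f g phi X xs ->
  forall y, X y -> manifold phi xs y ->
    - dotp (gradient f xs) (y - xs) <= fine (g y) - fine (g xs).
Proof.
move=> hP [Xxs [v [_ vsub] vE]] _ y Xy My.
move/(canRL (addKr _)): vE; rewrite addr0 => vE.
have := vsub y My; rewrite (g_fin hP Xy) (g_fin hP Xxs) -EFinB lee_fin vE.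
rewrite dotpN dotp_proj_tangent// => b Bb.
by rewrite !mxE (My b Bb) subrr.
Qed.

(** * From one step to [K] steps *)

Theorem theorem3p2 (R : realType) (n : nat)
    (f : 'rV[R]_n -> R) (g : 'rV[R]_n -> \bar R)
    (phi : R -> \bar R) (h : 'rV[R]_n -> \bar R)
    (gamma : 'rV[R]_n -> 'rV[R]_n -> R)
    (X : set 'rV[R]_n) (tbar t : R) (xstar : 'rV[R]_n)
    (hP : problem_assumptions f g phi h X)
    (hG : surrogate_assumptions f g h X gamma tbar)
    (ht : 0 < t < tbar)
    (hx : spurious_stationary f g phi X xstar) :
  forall (K : nat) (eps : R), 0 < eps ->
    exists x0 : 'rV[R]_n,
      (eball xstar eps `&` X `&` (dom h)°) x0 /\
      exists x : nat -> 'rV[R]_n,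
        [/\ x 0%N = x0,
            generated gamma g h X t x
          & forall k, (1 <= k <= K)%N -> eball xstar eps (x k)].
Proof.
move=> K eps eps0; have Xs : X xstar by case: hx.
have [[w Sw] _] := X_domh hP.
have stat := spurious_stationary_ge hP hx.
(* Stated as an implication so that [choice] yields a total map [T]. *)
pose next_spec x y := ((dom h)° `&` X) x -> [/\ ((dom h)° `&` X) y,
  objective g phi gamma t x y <= objective g phi gamma t x x &
  argmin (fun z => subproblem gamma g h t z x) = [set y]].
have next_ex x : exists y, next_spec x y.
  have [Sx|nSx] := pselect (((dom h)° `&` X) x).
    by have [y Hy] := argmin_subproblem hP hG ht Sx; exists y.
  by exists x.
have [T HT] := choice next_ex.
have Siter x k : ((dom h)° `&` X) x -> ((dom h)° `&` X) (iter k T x).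
  by move=> Sx; elim: k => //= k /HT[].
(* The Euclidean norm is at most [n] times the sup norm; [n.+1] also covers dimension zero. *)
pose e := eps / n.+1%:R.
have e0 : 0 < e by rewrite divr_gt0.
have [d d0 Hd] : exists2 d, 0 < d & forall x, ((dom h)° `&` X) x ->
    `|x - xstar| < d -> forall k, (k <= K)%N -> `|iter k T x - xstar| < e.
  elim: K => [|K [d d0 Hd]].
    by exists e => // x _ xe k; rewrite leqn0 => /eqP ->.
  (* The first step is confined to the radius [d] that suffices for the remaining [K] steps. *)
  have [d1 d10 Hd1] := iterate_near hP hG ht Sw Xs stat d0.
  exists (Num.min e d1); first by rewrite lt_min e0.
  move=> x Sx; rewrite lt_min => /andP[xe xd1] [|k] kK //.
  have [STx Tx _] := HT x Sx.
  by rewrite iterSr; apply: Hd => //; exact: Hd1 Tx.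
have inball y : `|y - xstar| < e -> eball xstar eps y.
  rewrite /e ltr_pdivlMr// => /ltW ye; rewrite /eball /=.
  apply: le_trans (norm2_le_normr _) _; rewrite distrC mulrC.
  by apply: le_trans ye; rewrite ler_wpM2l// ler_nat.
(* The initial point is a small step from [xstar] towards the interior point [w]. *)
have [s [sd s01]] : exists s : R, `|xstar + s *: (w - xstar) - xstar| < d /\ 0 <
  s <= 1.
  apply: (@filter_ex _ (0 : R)^'+); apply: filterI.
    have Pd : nbhs xstar [set y | `|y - xstar| < d].
      apply/nbhs_ballP; exists d => // y.
      by rewrite -ball_normE /= distrC.
    exact: near_ray Pd.
  near=> s; apply/andP; split; near: s; first exact: nbhs_right_gt.
  exact: nbhs_right_le.
have Sx0 := S_ray hP Sw Xs Sw s01.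
exists (xstar + s *: (w - xstar)); split.
  split; last exact: Sx0.1.
  by split; [apply: inball; exact: (Hd _ Sx0 sd 0%N)|exact: Sx0.2].
exists (fun k => iter k T (xstar + s *: (w - xstar))); split =>
  // [k|k /andP[_ kK]].
  have Sk := Siter _ k Sx0; split => //.
  by have [_ _ ->] := HT _ Sk.
exact/inball/Hd.
Unshelve. all: end_near. Qed.
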